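(* There exists an absolute constant $c>0$ such that the following holds. Let $n,k$ be integers with $1\le k<n$, and let $K$ and $L$ be origin-symmetric star bodies in $\mathbb{R}^n$ such that $L\subset K$. Then $$d_k^k(L,\mathcal{BP}_k^n)\left(|K|^{\frac{n-k}{n}}-|L|^{\frac{n-k}{n}}\right)\ge c^k\,\frac{1}{(\sqrt n\,M(\overline L))^k}\,\min_{F\in{\rm Gr}_{n-k}}\big(|K\cap F|-|L\cap F|\big).$$
   Context: $|\cdot|$ denotes volume (Lebesgue measure) of the appropriate dimension, ${\rm Gr}_{n-k}$ is the Grassmannian of $(n-k)$-dimensional linear subspaces of $\mathbb{R}^n$, and $\sigma$ is the normalized (probability) Lebesgue measure on $S^{n-1}$. A closed bounded set $K\subset\mathbb{R}^n$ is a star body if every straight line through the origin crosses the boundary of $K$ at exactly two points different from the origin, the origin is an interior point of $K$, and the Minkowski functional $\|x\|_K=\min\{a\ge 0: x\in aK\}$ is continuous on $\mathbb{R}^n$. Its radial function is $\rho_K(x)=\|x\|_K^{-1}$, $x\ne 0$. Origin-symmetric means $K=-K$. Put $\overline L=L/|L|^{1/n}$ and $M(L)=\int_{S^{n-1}}\|\theta\|_L\,d\sigma(\theta)$. The $(n-k)$-dimensional spherical Radon transform $R_{n-k}:C(S^{n-1})\to C({\rm Gr}_{n-k})$ is $R_{n-k}g(E)=\int_{S^{n-1}\cap E}g(\theta)\,d\theta$, where $d\theta$ is the (non-normalized) Lebesgue measure on the sphere $S^{n-1}\cap E$ (counting measure if $\dim E=1$). An origin-symmetric star body $D$ in $\mathbb{R}^n$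 is a generalized $k$-intersection body, written $D\in\mathcal{BP}_k^n$, if there exists a finite non-negative Borel measure $\mu_D$ on ${\rm Gr}_{n-k}$ such that for every $g\in C(S^{n-1})$, $\int_{S^{n-1}}\rho_D^k(\theta)g(\theta)\,d\theta=\int_{{\rm Gr}_{n-k}}R_{n-k}g(H)\,d\mu_D(H)$. For a star body $K$ in $\mathbb{R}^n$, $$d_k(K,\mathcal{BP}_k^n)=\inf\left\{\left(\frac{\int_{S^{n-1}}\|\theta\|_K^{-k}\,d\sigma(\theta)}{\int_{S^{n-1}}\|\theta\|_D^{-k}\,d\sigma(\theta)}\right)^{1/k}: D\subset K,\ D\in\mathcal{BP}_k^n\right\},$$ and $d_k^k$ denotes the $k$-th power of $d_k$. *)

(* Defs.v *)
From HB Require Import structures.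
From mathcomp Require Import all_boot all_order all_algebra.
From mathcomp Require Import all_classical all_reals all_analysis.
From mathcomp Require Import measurable_realfun.
Import Order.TTheory GRing.Theory Num.Theory.
Import numFieldNormedType.Exports.

Set Implicit Arguments.
Unset Strict Implicit.
Unset Printing Implicit Defensive.

Local Open Scope classical_set_scope.
Local Open Scope ring_scope.

(* R^n is 'rV[R]_n, with the sigma-algebra generated by the coordinates, which
   is the Borel sigma-algebra. *)
Section measurable_rV.
Context {R : realType} (n : nat).

Let coord (i : 'I_n) (x : 'rV[R]_n) : R := x ord0 i.

Let rV_set0 : g_sigma_preimage coord set0.
Proof. exact: sigma_algebra0. Qed.

Let rV_setC A : g_sigma_preimage coord A -> g_sigma_preimage coord (~` A).
Proof. exact: sigma_algebraC. Qed.

Let rV_bigcup (F : (set _)^nat) : (forall i, g_sigma_preimage coord (F i)) ->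
  g_sigma_preimage coord (\bigcup_i (F i)).
Proof. exact: sigma_algebra_bigcup. Qed.

HB.instance Definition _ := @isMeasurable.Build default_measure_display
  'rV[R]_n (g_sigma_preimage coord) rV_set0 rV_setC rV_bigcup.

Lemma measurable_coord (i : 'I_n) :
  measurable_fun [set: 'rV[R]_n] (fun x : 'rV[R]_n => x ord0 i).
Proof.
move=> _ Y mY; rewrite setTI; apply: sub_sigma_algebra => /=.
rewrite -bigcup_seq/=; exists i => /=; first by rewrite mem_index_enum.
by exists Y => //; rewrite setTI.
Qed.

Lemma measurable_rVP d (T : measurableType d) (f : T -> 'rV[R]_n) :
  (forall i, measurable_fun [set: T] (fun t => f t ord0 i)) ->
  measurable_fun [set: T] f.
Proof.
move=> mf; apply: (@measurability _ _ _ _ _ _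
  (\big[setU/set0]_(i < n) preimage_set_system setT (coord i) measurable)).
  by [].
move=> _ [B + <-]; rewrite -bigcup_seq => -[i _ [Y mY <-]].
by rewrite setTI; apply: mf.
Qed.

End measurable_rV.

Lemma measurable_mulmx (R : realType) m n (A : 'M[R]_(m, n)) :
  measurable_fun [set: 'rV[R]_m] (mulmxr A).
Proof.
apply: measurable_rVP => i.
under eq_fun do rewrite mxE.
apply: measurable_sum => j.
apply: (measurable_funM (measurable_coord j)).
exact: measurable_cst.
Qed.

Definition image_measure d d' (T : measurableType d) (T' : measurableType d')
    (R : realType) (mu : {measure set T -> \bar R}) (f : T -> T')
    (mf : measurable_fun [set: T] f) : {measure set T' -> \bar R} :=
  measure_function_pushforward__canonical__measure_function_Measure mu mf.

Section lebesgue_rV.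
Context {R : realType}.

Definition cons_rV n (p : R * 'rV[R]_n) : 'rV[R]_n.+1 :=
  row_mx (p.1)%:M p.2 : 'rV_(1 + n).

Lemma measurable_cons_rV n : measurable_fun [set: R * 'rV[R]_n] (@cons_rV n).
Proof.
apply: measurable_rVP => i; rewrite /cons_rV.
under eq_fun do rewrite mxE.
case: splitP => j _.
- under eq_fun do rewrite (ord1 j) mxE eqxx mulr1n.
  exact: measurable_fst.
- exact: (measurableT_comp (measurable_coord j) measurable_snd).
Qed.

Lemma cons_rV0 n (p : R * 'rV[R]_n) : cons_rV p ord0 ord0 = p.1.
Proof.
by rewrite /cons_rV mxE; case: splitP => // j _; rewrite (ord1 j) mxE.
Qed.

Lemma cons_rVS n (p : R * 'rV[R]_n) j : cons_rV p ord0 (lift ord0 j) = p.2 ord0 j.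
Proof.
rewrite /cons_rV mxE; case: splitP => k /=; rewrite /bump /= add1n.
  by case: k => -[].
by move=> [jk]; congr (p.2 _ _); exact: val_inj.
Qed.

Definition uncons_rV n (x : 'rV[R]_n.+1) : R * 'rV[R]_n :=
  (x ord0 ord0, \row_j x ord0 (lift ord0 j)).

Lemma cons_rVK n : cancel (@cons_rV n) (@uncons_rV n).
Proof.
move=> [t y]; rewrite /uncons_rV cons_rV0; congr pair.
by apply/rowP => j; rewrite mxE cons_rVS.
Qed.

Lemma measurable_uncons_rV n :
  measurable_fun [set: 'rV[R]_n.+1] (@uncons_rV n).
Proof.
apply/measurable_fun_pair; first exact: measurable_coord.
apply: measurable_rVP => j.
under eq_fun do rewrite mxE.
exact: measurable_coord.
Qed.

Section step.
Context n (mu : {sigma_finite_measure set 'rV[R]_n -> \bar R}).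

Definition lebesgue_rVS : set 'rV[R]_n.+1 -> \bar R :=
  image_measure (lebesgue_measure \x mu)%E (@measurable_cons_rV n).

HB.instance Definition _ := Measure.on lebesgue_rVS.

Let lebesgue_rVS_sigma_finite : sigma_finite setT lebesgue_rVS.
Proof.
have /sigma_finiteP[F [TF ndF Foo]] := sigma_finiteT (@lebesgue_measure R).
have /sigma_finiteP[G [TG ndG Goo]] := sigma_finiteT mu.
exists (fun k => @uncons_rV n @^-1` (F k `*` G k)).
  apply/seteqP; split => // x _.
  have [i _ Fi] : (\bigcup_i F i) (uncons_rV x).1 by rewrite -TF.
  have [j _ Gj] : (\bigcup_i G i) (uncons_rV x).2 by rewrite -TG.
  exists (maxn i j) => //; split.
  - by apply: (subsetPset _ _ (ndF _ _ (leq_maxl i j))).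
  - by apply: (subsetPset _ _ (ndG _ _ (leq_maxr i j))).
move=> k; have [mF Fk] := Foo k; have [mG Gk] := Goo k; split.
  rewrite -[X in measurable X]setTI; apply: measurable_uncons_rV => //.
  exact: measurableX.
rewrite /lebesgue_rVS /image_measure /= /pushforward -comp_preimage.
rewrite (_ : _ \o _ = id) ?preimage_id; last exact/funext/cons_rVK.
by rewrite product_measure1E// lte_mul_pinfty// ge0_fin_numE.
Qed.

HB.instance Definition _ := Measure_isSigmaFinite.Build _ _ _ lebesgue_rVS
  lebesgue_rVS_sigma_finite.
End step.

Fixpoint lebesgue_rV n : {sigma_finite_measure set 'rV[R]_n -> \bar R} :=
  if n is n'.+1 then lebesgue_rVS (lebesgue_rV n') else \d_(0 : 'rV[R]_0).

End lebesgue_rV.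


Section euclidean.
Context {R : realType} {n : nat}.
Implicit Types (x : 'rV[R]_n) (mu : {measure set 'rV[R]_n -> \bar R}).

Definition enorm x : R := Num.sqrt (\sum_i x ord0 i ^+ 2).

Definition sphere : set 'rV[R]_n := [set x | enorm x = 1].

Definition radial_proj x : 'rV[R]_n := (enorm x)^-1 *: x.

Lemma measurable_enorm : measurable_fun [set: 'rV[R]_n] enorm.
Proof.
apply: (measurableT_comp (continuous_measurable_fun (@sqrt_continuous R))).
apply: measurable_sum => i; apply: measurable_funX; exact: measurable_coord.
Qed.

Lemma measurable_radial_proj : measurable_fun [set: 'rV[R]_n] radial_proj.
Proof.
apply: measurable_rVP => i.
under eq_fun do rewrite mxE -powR_inv1 ?sqrtr_ge0//.
apply: measurable_funM (measurable_coord i).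
exact: (measurableT_comp (measurable_powR (-1)) measurable_enorm).
Qed.

Definition punctured_ball : set 'rV[R]_n := [set x | 0 < enorm x <= 1].

Lemma measurable_punctured_ball : measurable punctured_ball.
Proof.
rewrite (_ : punctured_ball = enorm @^-1` `]0, 1]).
  by rewrite -[X in measurable X]setTI; exact: measurable_enorm.
by apply/seteqP; split => x /=; rewrite in_itv.
Qed.

(* Polar coordinates: for mu the Lebesgue measure of an m-dimensional subspace E
   with m >= 1, the surface measure of A on the unit sphere of E is m times the
   volume of the part of the unit ball of E lying over A.  For m = 1 this is the
   counting measure on the two unit vectors of E. *)
Definition surface_measure (m : nat) mu : {measure set 'rV[R]_n -> \bar R} :=
  mscale m%:R%:nng
    (image_measure (mrestr mu measurable_punctured_ball)
                   measurable_radial_proj).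

End euclidean.

Section grassmannian.
Context {R : realType}.

Lemma gram_schmidt_rV m n (B : 'M[R]_(m, n)) : row_free B ->
  exists A : 'M[R]_(m, n), A *m A^T = 1%:M /\ (A :=: B)%MS.
Proof.
elim: m B => [|m IH] B fB.
  by exists B; split => //; rewrite (flatmx0 (B *m B^T)) (flatmx0 1%:M).
pose b : 'rV[R]_n := usubmx (B : 'M[R]_(1 + m, n)).
pose B' : 'M[R]_(m, n) := dsubmx (B : 'M[R]_(1 + m, n)).
have defB : B = col_mx b B' by rewrite vsubmxK.
have kB : forall u : 'rV[R]_(1 + m), u *m col_mx b B' = 0 -> u = 0.
  move=> u; rewrite -defB => uB; apply: (row_free_inj fB).
  by rewrite uB mul0mx.
have [|A' [A'A' eA']] := IH B'.
  apply: inj_row_free => v vB; have /kB : row_mx 0 v *m col_mx b B' = 0.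
    by rewrite mul_row_col mul0mx add0r.
  by rewrite -row_mx0 => /eq_row_mx[].
pose u := b - b *m A'^T *m A'.
have uA' : u *m A'^T = 0 by rewrite mulmxBl -!mulmxA A'A' mulmx1 subrr.
have u0 : u != 0.
  apply/eqP => /subr0_eq bE.
  have /submxP[w bw] : (b <= B')%MS by rewrite -eA' bE submxMl.
  have /kB : row_mx (1%:M : 'M[R]_1) (- w) *m col_mx b B' = 0.
    by rewrite mul_row_col mul1mx mulNmx -bw subrr.
  rewrite -row_mx0 => /eq_row_mx[/matrixP /(_ 0 0)/eqP].
  by rewrite !mxE oner_eq0.
pose s : R := (u *m u^T) 0 0.
have sE : s = \sum_i u 0 i ^+ 2.
  by rewrite /s [LHS]mxE; apply: eq_bigr => i _; rewrite [u^T i 0]mxE expr2.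
have s_gt0 : 0 < s.
  rewrite lt_def sE sumr_ge0 ?andbT; last by move=> i _; exact: sqr_ge0.
  apply: contra u0 => /eqP/(psumr_eq0P (fun i _ => sqr_ge0 _)) s0.
  apply/eqP/rowP => i; have /eqP := s0 i isT.
  by rewrite sqrf_eq0 => /eqP ->; rewrite mxE.
pose a := (Num.sqrt s)^-1 *: u.
have aA' : a *m A'^T = 0 by rewrite -scalemxAl uA' scaler0.
have sqs : Num.sqrt s != 0 by rewrite sqrtr_eq0 -ltNge.
have AA : col_mx a A' *m (col_mx a A')^T = 1%:M :> 'M[R]_(1 + m).
  rewrite tr_col_mx mul_col_row A'A' aA'.
  have -> : A' *m a^T = 0 by rewrite -[LHS]trmxK trmx_mul trmxK aA' trmx0.
  have -> : a *m a^T = 1%:M.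
    rewrite linearZ/= -scalemxAr -scalemxAl scalerA; apply/matrixP => i j.
    rewrite !ord1 [LHS]mxE -/s mxE eqxx mulr1n -invfM -expr2.
    by rewrite sqr_sqrtr ?ltW// mulVf// gt_eqF.
  by rewrite -scalar_mx_block.
exists (col_mx a A'); split; first exact: AA.
have bu : b = u + b *m A'^T *m A' by rewrite subrK.
have ua : u = Num.sqrt s *: a by rewrite scalerA divff// scale1r.
suff : (col_mx a A' :=: col_mx b B')%MS by rewrite -defB.
apply/eqmxP; rewrite !col_mx_sub; apply/andP; split; apply/andP; split.
- rewrite scalemx_sub// addmx_sub//; first by rewrite -addsmxE addsmxSl.
  rewrite -mulNmx (submx_trans (submxMl _ _))// eA'.
  by rewrite -addsmxE addsmxSr.
- by rewrite eA' -addsmxE addsmxSr.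
- rewrite bu addmx_sub//.
    by rewrite ua scalemx_sub// -addsmxE addsmxSl.
  by rewrite (submx_trans (submxMl _ _))// -addsmxE addsmxSr.
- by rewrite -eA' -addsmxE addsmxSr.
Qed.

Definition orthonormal_frame m n (V : {vspace 'rV[R]_n}) (A : 'M[R]_(m, n)) :=
  A *m A^T = 1%:M /\ forall x : 'rV[R]_n, (x \in V) = (x <= A)%MS.

Lemma orthonormal_frame_exists m n (V : {vspace 'rV[R]_n}) :
  \dim V = m -> exists A : 'M[R]_(m, n), orthonormal_frame V A.
Proof.
move=> dV; subst m.
pose B : 'M[R]_(\dim V, n) := \matrix_(i < \dim V) (vbasis V)`_i.
have BE (u : 'rV[R]_(\dim V)) : u *m B = \sum_i u ord0 i *: (vbasis V)`_i.
  by rewrite mulmx_sum_row; apply: eq_bigr => i _; rewrite rowK.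
have [|A [A1 AB]] := @gram_schmidt_rV _ _ B.
  apply: inj_row_free => u; rewrite BE => u0.
  have /freeP fV := basis_free (vbasisP V).
  by apply/rowP => i; rewrite mxE; exact: (fV (u ord0)).
exists A; split => // x; rewrite AB; apply/idP/idP => [xV|/submxP[u ->]].
  apply/submxP; exists (\row_i coord (vbasis V) i x).
  rewrite BE {1}(coord_vbasis xV); apply: eq_bigr => i _; rewrite mxE.
  by rewrite -tnth_nth (tnth_nth 0).
rewrite BE memv_suml// => i _; rewrite memvZ// vbasis_mem// mem_nth//.
by rewrite size_tuple.
Qed.

(* Indexed by the codimension k (with n - k truncated), so that it is inhabited
   for all n and k. *)
Definition Gr (n k : nat) := {V : {vspace 'rV[R]_n} | \dim V == (n - k)%N}.

Lemma Gr_inhabited n k :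
  exists V : {vspace 'rV[R]_n}, \dim V == (n - k)%N.
Proof.
pose X := vbasis (fullv : {vspace 'rV[R]_n}).
exists (<<take (n - k) X>>)%VS; apply/eqP.
have fX : free (take (n - k) X).
  have := basis_free (vbasisP (fullv : {vspace 'rV[R]_n})).
  by rewrite -/X -{1}(cat_take_drop (n - k) X) => /catl_free.
rewrite (eqP fX) size_takel// size_tuple dimvf /dim/= mul1n.
exact: leq_subr.
Qed.

End grassmannian.
Arguments Gr : clear implicits.

Section grassmannian_structure.
Context {R : realType} {n k : nat}.
Implicit Types (F : Gr R n k).

HB.instance Definition _ := Choice.on (Gr R n k).
HB.instance Definition _ := isPointed.Build (Gr R n k)
  (exist _ _ (projT2 (cid (@Gr_inhabited R n k)))).

Definition frame F : 'M[R]_(n - k, n) :=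
  projT1 (cid (orthonormal_frame_exists (eqP (valP F)))).

Lemma frameP F : orthonormal_frame (sval F) (frame F).
Proof. exact: projT2 (cid _). Qed.

(* The matrix (acting on row vectors) of the orthogonal projection onto F; it
   does not depend on the choice of the frame.  F |-> orth_proj F is injective
   and induces the usual topology of the Grassmannian. *)
Definition orth_proj F : 'M[R]_n := (frame F)^T *m frame F.

HB.instance Definition _ :=
  Topological.copy (Gr R n k) (initial_topology orth_proj).

Definition borel_Gr := g_sigma_algebraType (@open (Gr R n k)).

Definition Gr_set F : set 'rV[R]_n := [set x | x \in sval F].

(* Lebesgue measure of F, transported from R^(n-k) by the linear isometry onto F
   given by an orthonormal basis. *)
Definition lebesgue_Gr F : {measure set 'rV[R]_n -> \bar R} :=
  image_measure (lebesgue_rV (n - k)) (measurable_mulmx (frame F)).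

End grassmannian_structure.
Arguments borel_Gr : clear implicits.

Section star_bodies.
Context {R : realType} {n : nat}.
Implicit Types (K L D : set 'rV[R]_n) (x : 'rV[R]_n) (k : nat).

Definition vol K : R := fine (lebesgue_rV n K).

Definition section_vol k K (F : Gr R n k) : R :=
  fine (lebesgue_Gr F (K `&` Gr_set F)).

(* For closed K the infimum is attained as soon as the set is nonempty. *)
Definition minkowski_functional K x : R :=
  inf [set a : R | 0 <= a /\ exists2 y, K y & x = a *: y].

Definition radial K x : R := (minkowski_functional K x)^-1.

Definition boundary K : set 'rV[R]_n := closure K `\` interior K.

Definition line x : set 'rV[R]_n := range (fun t : R => t *: x).

Definition star_body K :=
  [/\ closed K, bounded_set K,
      forall u, u != 0 -> exists p q, p != q /\
        (line u `&` boundary K) `\ 0 = [set p; q],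
      interior K 0 & continuous (minkowski_functional K)].

Definition origin_symmetric K := [set - x | x in K] = K.

Definition sphere_measure : {measure set 'rV[R]_n -> \bar R} :=
  surface_measure n (lebesgue_rV n).

Definition sphere_measure_Gr k (E : Gr R n k) :
    {measure set 'rV[R]_n -> \bar R} :=
  surface_measure (n - k) (lebesgue_Gr E).

(* The default probability is irrelevant for n >= 1, where sphere_measure is
   finite and nonzero. *)
Definition sphere_prob : probability 'rV[R]_n R :=
  mnormalize sphere_measure \d_(0 : 'rV[R]_n).

Definition normalize L : set 'rV[R]_n :=
  [set (vol L `^ n%:R^-1)^-1 *: x | x in L].

Definition mean_functional L : R :=
  \int[sphere_prob]_(t in sphere) minkowski_functional L t.

Definition radon k (g : 'rV[R]_n -> R) (E : Gr R n k) : R :=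
  \int[sphere_measure_Gr E]_(t in sphere `&` Gr_set E) g t.

Definition gen_intersection_body k D :=
  [/\ star_body D, origin_symmetric D &
    exists mu : {finite_measure set (borel_Gr R n k) -> \bar R},
      forall g : 'rV[R]_n -> R, {within sphere, continuous g} ->
        \int[sphere_measure]_(t in sphere) (radial D t ^+ k * g t) =
        \int[mu]_H radon g H].

Definition radial_power_mean k K : R :=
  \int[sphere_prob]_(t in sphere) (minkowski_functional K t) ^- k.

(* The infimum is taken in the extended reals, so that inf set0 = +oo. *)
Definition dist_BP k K : \bar R :=
  ereal_inf [set ((radial_power_mean k K / radial_power_mean k D)
                    `^ (k%:R^-1))%:E
            | D in [set D | D `<=` K /\ gen_intersection_body k D]].

End star_bodies.

(* Main.v *)
Require Import Defs.
From mathcomp Require Import all_boot all_order all_algebra.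
From mathcomp Require Import all_classical all_reals all_analysis.
From mathcomp Require Import measurable_realfun ring lra.
Import Order.TTheory GRing.Theory Num.Theory.
Import numFieldNormedType.Exports.
Set Implicit Arguments.
Unset Strict Implicit.
Unset Printing Implicit Defensive.
Local Open Scope classical_set_scope.
Local Open Scope ring_scope.

(** Write rho for radial functions, B_j for the unit ball of dimension j, and
    let D be a generalized k-intersection body contained in L, represented by a
    measure mu on the Grassmannian.

    In polar coordinates, n - k times the volume of a section by an
    (n - k)-dimensional F is the Radon transform of rho^(n-k) at F
    ([radon_radial]).  So if all sections of K exceed those of L by at least e,
    then the Radon transform of g = rho_K^(n-k) - rho_L^(n-k) is everywhere at
    least (n - k) e.  Integrating against mu, and using the representation of D
    once for g and once for the constant 1 to compute the mass of mu, one gets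
      e * int rho_D^k <= |B_(n-k)| * int rho_D^k g.
    On the right, rho_D may be replaced by the larger rho_L because g >= 0, and
    Hoelder's inequality ([dual_mixed_volume_le]) bounds what results by
      n |L|^(k/n) (|K|^((n-k)/n) - |L|^((n-k)/n));
    this is [section_gap_le].

    What remains is to compare int rho_D^k with int rho_L^k, which is the ratio
    in the definition of the distance, and to bound the latter from below:
    Jensen's inequality gives a mean of rho_L^k of at least M(L)^-k
    ([radial_power_mean_ge]).  The ratio of volumes |B_n| / |B_(n-k)| that
    appears is at least (2 sqrt n)^-k, because a ball contains a cylinder of
    height of order n^(-1/2) over a hardly smaller ball of one dimension less
    ([ball_vol_succ]).  The outcome is [radial_power_mean_ratio], with c = 1/2,
    and it only remains to take the infimum over D.  If K and L have the same
    volume then they coincide ([star_body_vol_inj]) and both sides vanish, even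
    when the distance is infinite.

    Polar coordinates ([polar_coordinates]) are established for every measure
    that is homogeneous of some degree m > 0, so that the whole space and all
    its subspaces are treated at once. *)

(** * Borel sets of R^n and scaling of Lebesgue measure *)

Section borel_rV.
Context {R : realType} {n : nat}.

Lemma measurable_ball_rV (x : 'rV[R]_n) (e : R) : measurable (ball x e).
Proof.
have [e0|e0] := leP e 0.
  suff -> : ball x e = set0 by exact: measurable0.
  apply/seteqP; split => // y; rewrite mx_norm_ball /ball_ /=.
  by move=> /(le_lt_trans (normr_ge0 _)); rewrite ltNge e0.
have -> : ball x e = \big[setI/setT]_(i < n)
    ((fun y : 'rV[R]_n => y ord0 i) @^-1` ball (x ord0 i) e).
  rewrite -bigcap_seq; apply/seteqP; split => [y [_ xy] i _ /=|y xy].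
    exact: xy.
  split => // i j; rewrite (ord1 i).
  by apply: xy; rewrite /= mem_index_enum.
apply: bigsetI_measurable => i _.
by rewrite -[X in measurable X]setTI; apply: measurable_coord => //; exact: measurable_ball.
Qed.

(** An open set is the union of the countably many cubes with rational centre
    and radius 1 / (m + 1) that it contains. *)
Lemma open_measurable_rV (U : set 'rV[R]_n) : open U -> measurable U.
Proof.
move=> oU.
pose V (i : 'rV[rat]_n * nat) : set 'rV[R]_n :=
  ball (map_mx ratr i.1 : 'rV[R]_n) i.2.+1%:R^-1.
pose F k := if unpickle k is Some i then
  if `[< V i `<=` U >] then V i else set0 else set0.
suff -> : U = \bigcup_k F k.
  apply: bigcupT_measurable => k; rewrite /F.
  case: unpickle => // i; case: ifPn => // _; exact: measurable_ball_rV.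
apply/seteqP; split => [x Ux|x [k _]]; last first.
  by rewrite /F; case: unpickle => // i; case: ifPn => // /asboolP; apply.
have /nbhs_ballP[e /= e0 xeU] : nbhs x U by exact: open_nbhs_nbhs.
have [m me] : exists m : nat, m.+1%:R^-1 < e / 2.
  by exists (Num.truncn (e / 2)^-1); rewrite invf_plt ?posrE ?divr_gt0//; exact: truncnS_gt.
have /choice[q qP] : forall j, exists q : rat, `|x ord0 j - ratr q| < m.+1%:R^-1.
  move=> j; have [|q] := @rat_in_itvoo R (x ord0 j - m.+1%:R^-1) (x ord0 j + m.+1%:R^-1).
    by rewrite ltrD2l gtrN ?invr_gt0.
  by rewrite in_itv /= => /andP[q1 q2]; exists q; rewrite ltr_distlC q1.
pose i : 'rV[rat]_n * nat := (\row_j q j, m).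
have m0 : 0 < m.+1%:R^-1 :> R by rewrite invr_gt0.
have Vx : V i x.
  split=> // a b; rewrite (ord1 a) !mxE /ball /= distrC; exact: qP.
have VU : V i `<=` U.
  move=> y Vy; apply: xeU; apply: (@le_ball _ _ _ (m.+1%:R^-1 + m.+1%:R^-1)).
    by rewrite [leRHS]splitr lerD// ltW.
  by apply: ball_triangle Vy; exact: ball_sym.
exists (pickle i) => //; rewrite /F pickleK ifT//; exact/asboolP.
Qed.

Lemma closed_measurable_rV (U : set 'rV[R]_n) : closed U -> measurable U.
Proof.
move=> cU; rewrite -(setCK U); apply: measurableC.
by apply: open_measurable_rV; exact: closed_openC.
Qed.

Lemma continuous_measurable_rV (f : 'rV[R]_n -> R) :
  continuous f -> measurable_fun setT f.
Proof.
move=> /continuousP cf; apply: (measurability _ (RGenOpens.measurableE R)).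
move=> _ [_ [a [b ->] <-]]; rewrite setTI; apply: open_measurable_rV.
exact/cf/interval_open.
Qed.

End borel_rV.

Section scaling.
Context {R : realType}.

(** The scaling behaviour of the Lebesgue measure of an [m]-dimensional subspace,
    as a property of measures on the ambient space. *)
Definition homogeneous_measure n (m : nat) (mu : set 'rV[R]_n -> \bar R) :=
  forall (t : R) A, 0 < t -> measurable A ->
    mu A = ((t ^+ m)%:E * mu ( *:%R t @^-1` A))%E.

Lemma measurable_scale_rV n (t : R) :
  measurable_fun [set: 'rV[R]_n] ( *:%R t : 'rV[R]_n -> 'rV[R]_n).
Proof.
apply: measurable_rVP => i; under eq_fun do rewrite mxE.
exact: measurable_funM (measurable_cst _) (measurable_coord i).
Qed.

Lemma measurable_preimage_scale n (t : R) (A : set 'rV[R]_n) :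
  measurable A -> measurable ( *:%R t @^-1` A).
Proof.
by move=> mA; rewrite -[X in measurable X]setTI; exact: measurable_scale_rV.
Qed.

Lemma lebesgue_measure_scale (t : R) (A : set R) : 0 < t -> measurable A ->
  (lebesgue_measure A = t%:E * lebesgue_measure ((fun x => (t * x)%R) @^-1` A))%E.
Proof.
move=> t0 mA.
have mt : measurable_fun [set: R] (fun x : R => t * x).
  exact: measurable_funM (measurable_cst _) (@measurable_id _ _ _).
pose nu : {measure set (measurableTypeR R) -> \bar R} :=
  mscale (NngNum (ltW t0)) (image_measure (@lebesgue_measure R)
    (mt : measurable_fun setT (fun x => t * x : measurableTypeR R))).
change (lebesgue_measure A = nu A).
refine (@lebesgue_measure_unique R nu _ A mA) => _ [[a b] _ <-] /=.
rewrite /nu /mscale /= /pushforward.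
have -> : (fun x => t * x) @^-1` `]a, b] = `]a / t, b / t]%classic.
  apply/seteqP; split => x /=; rewrite !in_itv /= ltr_pdivrMr// ler_pdivlMr//;
    by rewrite (mulrC x).
rewrite !lebesgue_measure_itv /= !lte_fin ltr_pM2r ?invr_gt0//.
case: ifPn => _; last by rewrite mule0.
by rewrite -!EFinD -EFinM -mulrBl mulrCA divff ?mulr1// gt_eqF.
Qed.

(** By uniqueness of product measures it suffices to scale rectangles. *)
Lemma lebesgue_rV_homogeneous n : homogeneous_measure n (@lebesgue_rV R n).
Proof.
elim: n => [|n IH] t A t0 mA.
  rewrite expr0 mul1e; congr (lebesgue_rV 0 _); apply/seteqP.
  by split=> x /=; rewrite (_ : t *: x = x)//; apply/rowP => -[].
pose m2 (p : measurableTypeR R * 'rV[R]_n) : measurableTypeR R * 'rV[R]_n :=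
  (t * p.1, t *: p.2).
have mm2 : measurable_fun setT m2.
  apply/measurable_fun_pair.
    exact: measurable_funM (measurable_cst _) measurable_fst.
  exact: measurableT_comp (measurable_scale_rV t) measurable_snd.
have cE p : t *: @cons_rV R n p = cons_rV (m2 p).
  apply/rowP => i; rewrite mxE.
  have [j ->|->] := unliftP ord0 i; first by rewrite !cons_rVS mxE.
  by rewrite !cons_rV0.
have tn0 : 0 <= t ^+ n.+1 by rewrite exprn_ge0// ltW.
pose nu : {measure set (measurableTypeR R * 'rV[R]_n) -> \bar R} := mscale (NngNum tn0)
   (image_measure ((@lebesgue_measure R) \x lebesgue_rV n)%E mm2).
rewrite /= /lebesgue_rVS /image_measure /= /pushforward.
have -> : @cons_rV R n @^-1` ( *:%R t @^-1` A) = m2 @^-1` (@cons_rV R n @^-1` A).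
  by apply/seteqP; split => p /=; rewrite cE.
have mcA : measurable (@cons_rV R n @^-1` A).
  by rewrite -[X in measurable X]setTI; exact: measurable_cons_rV.
change ((lebesgue_measure \x lebesgue_rV n)%E (@cons_rV R n @^-1` A) =
        nu (@cons_rV R n @^-1` A)).
refine (@product_measure_unique _ _ (measurableTypeR R) 'rV[R]_n R
  (@lebesgue_measure R) (lebesgue_rV n) nu _ _ mcA) => B C mB mC.
have mtB : measurable ((fun x => t * x) @^-1` B).
  rewrite -[X in measurable X]setTI.
  have := measurable_funM (measurable_cst t) (@measurable_id _ R setT).
  by apply.
change ((t ^+ n.+1)%:E * ((@lebesgue_measure R) \x lebesgue_rV n)
  (((fun x => (t * x)%R) @^-1` B) `*` ( *:%R t @^-1` C)) =
  lebesgue_measure B * lebesgue_rV n C)%E.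
rewrite product_measure1E//; last exact: measurable_preimage_scale.
rewrite (lebesgue_measure_scale t0 mB) (IH t C t0 mC) exprS EFinM.
by rewrite muleACA.
Qed.

End scaling.

(** * The Euclidean norm and the volume of the unit ball *)

Section enorm_theory.
Context {R : realType}.

Lemma enorm_ge0 n (x : 'rV[R]_n) : 0 <= enorm x.
Proof. exact: sqrtr_ge0. Qed.

Lemma sqr_enorm n (x : 'rV[R]_n) : enorm x ^+ 2 = \sum_i x ord0 i ^+ 2.
Proof. by rewrite sqr_sqrtr// sumr_ge0// => i _; exact: sqr_ge0. Qed.

Lemma enormZ n (t : R) (x : 'rV[R]_n) : enorm (t *: x) = `|t| * enorm x.
Proof.
rewrite /enorm -sqrtr_sqr -sqrtrM ?sqr_ge0//; congr Num.sqrt.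
by rewrite mulr_sumr; apply: eq_bigr => i _; rewrite mxE exprMn.
Qed.

Lemma enorm0 n : enorm (0 : 'rV[R]_n) = 0.
Proof. by rewrite -(scale0r (0 : 'rV[R]_n)) enormZ normr0 mul0r. Qed.

Lemma enorm_cons n (p : R * 'rV[R]_n) :
  enorm (cons_rV p) ^+ 2 = p.1 ^+ 2 + enorm p.2 ^+ 2.
Proof.
rewrite !sqr_enorm big_ord_recl cons_rV0; congr (_ + _).
by apply: eq_bigr => i _; rewrite cons_rVS.
Qed.

Lemma norm_coord_le_enorm n (x : 'rV[R]_n) i : `|x ord0 i| <= enorm x.
Proof.
rewrite -(ler_pXn2r (_ : 0 < 2)%N) ?nnegrE ?enorm_ge0// sqr_enorm real_normK ?num_real//.
by rewrite (bigD1 i)//= lerDl sumr_ge0// => j _; exact: sqr_ge0.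
Qed.

Lemma enorm_eq0 n (x : 'rV[R]_n) : (enorm x == 0) = (x == 0).
Proof.
apply/eqP/eqP => [x0|->]; last exact: enorm0.
apply/rowP => i; rewrite mxE; apply/eqP; rewrite -normr_le0 -x0.
exact: norm_coord_le_enorm.
Qed.

Lemma enorm_gt0 n (x : 'rV[R]_n) : (0 < enorm x) = (x != 0).
Proof. by rewrite lt_def enorm_ge0 andbT enorm_eq0. Qed.

Lemma supnorm_le_enorm n (x : 'rV[R]_n) : `|x| <= enorm x.
Proof.
rewrite [leLHS]mx_normrE; apply/bigmax_leP; split; first exact: enorm_ge0.
by move=> [i j] _ /=; rewrite (ord1 i) norm_coord_le_enorm.
Qed.

Lemma enorm_le_supnorm n (x : 'rV[R]_n) : enorm x <= Num.sqrt n%:R * `|x|.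
Proof.
rewrite -(ler_pXn2r (_ : 0 < 2)%N) ?nnegrE ?enorm_ge0 ?mulr_ge0 ?sqrtr_ge0//.
rewrite sqr_enorm exprMn sqr_sqrtr//.
rewrite -[n in n%:R]card_ord -sum1_card natr_sum mulr_suml.
apply: ler_sum => i _; rewrite mul1r -real_normK ?num_real//.
rewrite lerXn2r ?nnegrE//.
by rewrite [leRHS]mx_normrE; apply/bigmax_geP; right; exists (ord0, i).
Qed.

End enorm_theory.

Lemma bernoulli_ineq {R : realType} (v : R) n : 0 <= v ->
  1 + n%:R * (v - 1) <= v ^+ n.
Proof.
move=> v0; elim: n => [|n IH]; first by rewrite mul0r addr0 expr0.
rewrite exprS (le_trans _ (ler_wpM2l v0 IH))// -(natr1 n).
have h : 0 <= n%:R * (v - 1) ^+ 2 by rewrite mulr_ge0 ?sqr_ge0.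
nra.
Qed.

Section volumes.
Context {R : realType}.

Lemma lebesgue_rV_cons n (A : set 'rV[R]_n.+1) :
  lebesgue_rV n.+1 A =
  ((@lebesgue_measure R) \x lebesgue_rV n)%E (@cons_rV R n @^-1` A).
Proof. by []. Qed.

(** The balls of the ambient topology are cubes; their explicit volume makes
    bounded sets finite and sets with interior points positive in measure. *)
Lemma lebesgue_rV_supball n (a : 'rV[R]_n) (r : R) : 0 < r ->
  lebesgue_rV n (ball a r) = ((r *+ 2) ^+ n)%:E.
Proof.
move=> r0; elim: n a => [|n IH] a.
  by rewrite /= diracE mem_set//; split => // i; case.
have mb : measurable (ball (\row_j a ord0 (lift ord0 j)) r).
  exact: measurable_ball_rV.
rewrite lebesgue_rV_cons (_ : _ @^-1` _ =
  ball (a ord0 ord0) r `*` ball (\row_j a ord0 (lift ord0 j)) r); last first.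
  apply/seteqP; split => p.
    move=> [_ ap]; split; first by have := ap ord0 ord0; rewrite cons_rV0.
    split => // i j; rewrite (ord1 i) mxE.
    by have := ap ord0 (lift ord0 j); rewrite cons_rVS.
  move=> [p1 [_ p2]]; split => // i j; rewrite (ord1 i).
  have [k ->|->] := unliftP ord0 j; last by rewrite cons_rV0.
  by have := p2 ord0 k; rewrite cons_rVS mxE.
rewrite product_measure1E//; last exact: measurable_ball.
by rewrite [X in (X * _)%E](lebesgue_measure_ball _ (ltW r0)) IH exprS EFinM.
Qed.

Lemma measurable_enorm_le n (r : R) :
  measurable [set x : 'rV[R]_n | enorm x <= r].
Proof.
rewrite (_ : [set _ | _] = @enorm R n @^-1` `]-oo, r]).
  by rewrite -[X in measurable X]setTI; exact: measurable_enorm.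
by apply/seteqP; split => x /=; rewrite in_itv.
Qed.

Definition unit_ball n : set 'rV[R]_n := [set x | enorm x <= 1].
Arguments unit_ball : clear implicits.
Definition ball_vol n : R := vol (unit_ball n).

Lemma lebesgue_rV_unit_ball n : lebesgue_rV n (unit_ball n) = (ball_vol n)%:E.
Proof.
rewrite /ball_vol /vol fineK// ge0_fin_numE//.
apply: (@le_lt_trans _ _ (lebesgue_rV n (ball 0 2))).
  apply: le_measure; rewrite ?inE; [exact: measurable_enorm_le|exact: measurable_ball_rV|].
  move=> x /= x1; rewrite mx_norm_ball /ball_ /= sub0r normrN.
  by rewrite (le_lt_trans (supnorm_le_enorm x))// (le_lt_trans x1)// ltr1n.
by rewrite lebesgue_rV_supball ?ltry// ltr0n.
Qed.

Lemma ball_vol_gt0 n : 0 < ball_vol n.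
Proof.
rewrite -lte_fin -lebesgue_rV_unit_ball.
pose r : R := (Num.sqrt n%:R + 1)^-1.
have s0 : 0 < Num.sqrt n%:R + 1 :> R by rewrite ltr_wpDl ?sqrtr_ge0.
have r0 : 0 < r by rewrite invr_gt0.
apply: (@lt_le_trans _ _ (lebesgue_rV n (ball 0 r))).
  by rewrite lebesgue_rV_supball// lte_fin exprn_gt0// mulrn_wgt0.
apply: le_measure; rewrite ?inE; [exact: measurable_ball_rV|exact: measurable_enorm_le|].
move=> x /=; rewrite mx_norm_ball /ball_ /= sub0r normrN => xr.
apply: (le_trans (enorm_le_supnorm x)).
apply: (@le_trans _ _ (Num.sqrt n%:R * r)).
  by rewrite ler_wpM2l ?sqrtr_ge0// ltW.
by rewrite ler_pdivrMr// mul1r lerDl.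
Qed.

(** The unit ball contains the cylinder of half-height [s] over the ball of
    radius [1 - s ^ 2]; with [s ^ 2 = 1 / (4 (n + 1))] the cross-section has lost only
    a constant factor of its volume. *)
Lemma ball_vol_succ n :
  2^-1 / Num.sqrt n.+1%:R * ball_vol n <= ball_vol n.+1.
Proof.
set q : R := Num.sqrt n.+1%:R.
have q0 : 0 < q by rewrite sqrtr_gt0.
have q2 : q ^+ 2 = n.+1%:R by rewrite sqr_sqrtr.
pose s : R := 2^-1 / q.
have s0 : 0 < s by rewrite divr_gt0.
have s2 : s ^+ 2 * (4 * n.+1%:R) = 1.
  by rewrite /s -q2 expr_div_n; field; rewrite gt_eqF.
have n0 : 0 <= n%:R :> R by [].
have s21 : s ^+ 2 <= 4^-1.
  have := mulr_ge0 (sqr_ge0 s) n0; move: s2; rewrite -(natr1 n) => s2 ns; lra.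
pose t := 1 - s ^+ 2.
have t0 : 0 < t by rewrite /t; lra.
pose B : set 'rV[R]_n := [set y | enorm y <= t].
have mB : measurable B by exact: measurable_enorm_le.
have volB : lebesgue_rV n B = (t ^+ n * ball_vol n)%:E.
  rewrite (lebesgue_rV_homogeneous t0 mB) EFinM -lebesgue_rV_unit_ball.
  congr (_ * lebesgue_rV n _)%E; apply/seteqP; split => x;
    by rewrite /B /unit_ball /= enormZ gtr0_norm// ger_pMr.
have tn : 2^-1 <= t ^+ n.
  apply: le_trans (bernoulli_ineq n (ltW t0)); rewrite /t.
  by move: s2; rewrite -(natr1 n) => s2; have := sqr_ge0 s => s20; lra.
rewrite -lee_fin -lebesgue_rV_unit_ball.
apply: (@le_trans _ _ (((@lebesgue_measure R) \x lebesgue_rV n)%E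
   (ball 0 s `*` B))).
  rewrite product_measure1E//; last exact: measurable_ball.
  rewrite [X in (_ <= X * _)%E](lebesgue_measure_ball _ (ltW s0)) volB -EFinM lee_fin mulrA.
  apply: ler_wpM2r; first by rewrite ltW// ball_vol_gt0.
  by rewrite -/s mulr2n; nra.
have mc : measurable (@cons_rV R n @^-1` unit_ball n.+1).
  rewrite -[X in measurable X]setTI; apply: measurable_cons_rV => //.
  exact: measurable_enorm_le.
apply: le_measure; rewrite ?inE; [|exact: mc|].
  by apply: measurableX => //; exact: measurable_ball.
move=> [a y] [/= ax yB]; rewrite /unit_ball /=.
rewrite -(ler_pXn2r (_ : 0 < 2)%N) ?nnegrE ?enorm_ge0// enorm_cons/= expr1n.
have a2 : a ^+ 2 <= s ^+ 2.
  have as_ : `|a| <= s by move: ax; rewrite /ball/= sub0r normrN => /ltW.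
  by rewrite -[leLHS]real_normK ?num_real// lerXn2r ?nnegrE// ltW.
have y2 : enorm y ^+ 2 <= t ^+ 2.
  by rewrite ler_pXn2r ?nnegrE ?enorm_ge0// ltW.
have := sqr_ge0 s; rewrite /t in y2; nra.
Qed.

Lemma ball_vol_ratio m k :
  (2^-1 / Num.sqrt (m + k)%:R) ^+ k * ball_vol m <= ball_vol (m + k).
Proof.
elim: k => [|k IH]; first by rewrite expr0 mul1r addn0.
have h0 j : 0 <= 2^-1 / Num.sqrt j%:R :> R by rewrite divr_ge0 ?sqrtr_ge0.
rewrite addnS (le_trans _ (ball_vol_succ _))// exprS -mulrA ler_wpM2l//.
case: k IH => [|k] IH; first by rewrite expr0 mul1r addn0.
apply: le_trans IH; rewrite ler_wpM2r ?(ltW (ball_vol_gt0 _))//.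
rewrite lerXn2r ?nnegrE// ler_wpM2l// lef_pV2 ?posrE ?sqrtr_gt0 ?ltr0n ?addnS//.
by rewrite ler_sqrt// ler_nat.
Qed.

End volumes.
Arguments unit_ball : clear implicits.

(** * Polar coordinates *)

Section polar.
Context {R : realType} {n m : nat} (mu : {measure set 'rV[R]_n -> \bar R}).
Hypothesis mu_hom : homogeneous_measure m mu.

(** [B] contains the contractions of [A] by all factors [t < 1], and their
    measures [t ^ m * mu A] tend to [mu A].  This is how boundaries of
    star-shaped sets are seen to be negligible. *)
Lemma homogeneous_measure_le (A B : set 'rV[R]_n) :
  measurable A -> measurable B ->
  (forall t : R, 0 < t < 1 -> A `<=` *:%R t @^-1` B) -> (mu A <= mu B)%E.
Proof.
move=> mA mB AB.
have tAB (t : R) : 0 < t < 1 -> ((t ^+ m)%:E * mu A <= mu B)%E.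
  move=> /[dup] t01 /andP[t0 _]; rewrite (mu_hom t0 mB).
  apply: lee_wpmul2l; first by rewrite lee_fin exprn_ge0// ltW.
  apply: le_measure; rewrite ?inE//; last exact: AB.
  exact: measurable_preimage_scale.
have : (0 <= mu A)%E by []. have : (0 <= mu B)%E by [].
case: (mu B) tAB => [b| |] tAB; [|by move=> _ _; rewrite leey|by []].
move=> b0; case: (mu A) tAB => [a| |] tAB a0; [|exfalso|by []]; last first.
  have h : (0 < 2^-1 :> R) && (2^-1 < 1 :> R) by apply/andP; split; lra.
  by have := tAB _ h; rewrite gt0_muley ?lte_fin ?exprn_gt0 ?invr_gt0.
rewrite !lee_fin in a0 b0 *; apply/ler_addgt0Pr => e e0.
pose d := m%:R * a + e + 1.
have ma0 : 0 <= m%:R * a by rewrite mulr_ge0.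
have d0 : 0 < d by rewrite /d; lra.
(* at the ratio [1 - e / d], Bernoulli's inequality loses at most [e] *)
have ed : 0 < e / d < 1.
  by rewrite divr_gt0//= ltr_pdivrMr// mul1r /d; lra.
have := tAB (1 - e / d); rewrite subr_gt0 (andP ed).2 gtrBl (andP ed).1.
rewrite -EFinM lee_fin => /(_ isT).
have ed' : 0 <= 1 - e / d by rewrite subr_ge0 ltW// (andP ed).2.
move=> h; have := ler_wpM2r a0 (bernoulli_ineq m ed') => /le_trans/(_ h).
have : m%:R * a * (e / d) <= e.
  rewrite mulrA ler_pdivrMr// mulrC ler_wpM2l ?ltW// /d; lra.
by move=> h1 h2; lra.
Qed.

Hypothesis m_gt0 : (0 < m)%N.

Lemma radial_projZ (t : R) (x : 'rV[R]_n) : 0 < t ->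
  radial_proj (t *: x) = radial_proj x.
Proof.
move=> t0; rewrite /radial_proj enormZ gtr0_norm// invfM scalerA.
by rewrite -mulrA mulrCA mulVf ?mulr1// gt_eqF.
Qed.

(** The surface measure without its factor [m]. *)
Definition solid_angle : {measure set 'rV[R]_n -> \bar R} :=
  image_measure (mrestr mu (@measurable_punctured_ball R n))
                (@measurable_radial_proj R n).

Lemma solid_angleE A : solid_angle A = mu (radial_proj @^-1` A `&` punctured_ball).
Proof. by []. Qed.

(** The region with radial function [f ^ (1 / m)].  Taking the root makes its
    volume linear in [f], and the strict inequality makes it commute with
    increasing limits. *)
Definition radial_region (f : 'rV[R]_n -> R) : set 'rV[R]_n :=
  [set x | 0 < enorm x /\ enorm x ^+ m < f (radial_proj x)].

Lemma measurable_radial_region (f : 'rV[R]_n -> R) :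
  measurable_fun setT f -> measurable (radial_region f).
Proof.
move=> mf; pose b x := (0 < enorm x) && (enorm x ^+ m < f (radial_proj x)).
have mb : measurable_fun setT b.
  apply: measurable_and; apply: measurable_fun_ltr => //.
  - exact: measurable_enorm.
  - by apply: measurable_funX; exact: measurable_enorm.
  - exact: measurableT_comp mf (@measurable_radial_proj R n).
have -> : radial_region f = b @^-1` [set true].
  by apply/seteqP; split => x /= => [[h1 h2]|/andP[]//]; rewrite /b h1.
by rewrite -[X in measurable X]setTI; exact: mb.
Qed.

(** Scaling reduces to [r = 1]; the unit vectors, which [solid_angle] counts and
    the sector omits, are negligible. *)
Lemma radial_sector (A : set 'rV[R]_n) (r : R) : 0 <= r -> measurable A ->
  mu [set x | [/\ 0 < enorm x, enorm x ^+ m < r & A (radial_proj x)]] =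
  (r%:E * solid_angle A)%E.
Proof.
rewrite le_eqVlt => /predU1P[<- mA|r0 mA].
  rewrite mul0e (_ : [set _ | _] = set0) ?measure0//.
  by apply/seteqP; split => // x [x0 /=]; rewrite ltNge exprn_ge0// ltW.
pose C s : set 'rV[R]_n := [set x | [/\ 0 < enorm x, enorm x ^+ m < s & A (radial_proj x)]].
have mC s : measurable (C s).
  have -> : C s = radial_region (cst s) `&` radial_proj @^-1` A.
    by apply/seteqP; split => x; [move=> [? ? ?]; do !split|move=> [[? ?] ?]].
  apply: measurableI; first by apply: measurable_radial_region; exact: measurable_cst.
  by rewrite -[X in measurable X]setTI; exact: measurable_radial_proj.
have mS : measurable (radial_proj @^-1` A `&` punctured_ball).
  apply: measurableI; last exact: measurable_punctured_ball.
  by rewrite -[X in measurable X]setTI; exact: measurable_radial_proj.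
have C1 : mu (C 1) = solid_angle A.
  apply/eqP; rewrite eq_le solid_angleE; apply/andP; split.
    apply: le_measure; rewrite ?inE// => x [x0 x1 Ax]; split => //.
    by apply/andP; split => //; rewrite ltW// -(expr_lt1 m_gt0)// ltW.
  apply: homogeneous_measure_le => // t /andP[t0 t1] x /= [Ax /andP[x0 x1]].
  rewrite /C /= enormZ radial_projZ// gtr0_norm//; split => //.
    by rewrite mulr_gt0.
  rewrite expr_lt1// ?mulr_ge0 ?ltW//.
  by rewrite (le_lt_trans _ t1)// ler_piMr// ltW.
have s0 : 0 < r `^ m%:R^-1 by exact: powR_gt0.
have sr : (r `^ m%:R^-1) ^+ m = r.
  rewrite -powR_mulrn ?powR_ge0// -powRrM mulVf ?pnatr_eq0 -?lt0n// powRr1//.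
  exact: ltW.
rewrite -[LHS]/(mu (C r)) (mu_hom s0 (mC r)) sr -C1; congr (_ * mu _)%E.
apply/seteqP; split => x; rewrite /C /= enormZ radial_projZ// gtr0_norm//
  exprMn sr pmulr_rgt0// gtr_pMr//.
Qed.

Import HBNNSimple.

(** Over a level set of a simple function the region is a sector. *)
Lemma mu_radial_region_nnsfun (f : {nnsfun 'rV[R]_n >-> R}) :
  mu (radial_region f) = sintegral solid_angle f.
Proof.
have -> : radial_region f = \bigcup_(r in range f)
    [set x | [/\ 0 < enorm x, enorm x ^+ m < r & (f @^-1` [set r]) (radial_proj x)]].
  apply/seteqP; split => [x [x0 xf]|x [r _ [x0 xr /= fr]]].
    by exists (f (radial_proj x)) => //; exists (radial_proj x).
  by split => //; rewrite fr.
rewrite measure_fin_bigcup//; last 2 first.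
- move=> r s _ _ [x [[_ _ /= <-] [_ _ /= <-]]] //.
- move=> r _.
  rewrite (_ : [set _ | _] = radial_region (cst r) `&` radial_proj @^-1` (f @^-1` [set r])).
    apply: measurableI; first by apply: measurable_radial_region; exact: measurable_cst.
    by rewrite -[X in measurable X]setTI; exact: measurable_radial_proj.
  by apply/seteqP; split => x; [move=> [? ? ?]; do !split|move=> [[? ?] ?]].
rewrite sintegralE; apply: eq_fsbigr => r /set_mem[x _ <-].
exact: (@radial_sector (f @^-1` [set f x]) (f x)).
Qed.

(** Monotone convergence on both sides, from simple functions. *)
Lemma polar_coordinates (g : 'rV[R]_n -> R) : measurable_fun setT g ->
  (forall x, 0 <= g x) ->
  (\int[surface_measure m mu]_t (g t)%:E = m%:R%:E * mu (radial_region g))%E.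
Proof.
move=> mg g0.
have mEg : measurable_fun setT (EFin \o g) by exact/measurable_EFinP.
rewrite ge0_integral_mscale//; last by move=> x _; rewrite lee_fin.
congr (_ * _)%E; rewrite -[X in integral X]/(solid_angle : set _ -> \bar R).
pose h := nnsfun_approx measurableT mEg.
have hg x : EFin \o h^~ x @ \oo --> (g x)%:E.
  by apply: (cvg_nnsfun_approx measurableT mEg) => // y _; rewrite lee_fin.
have hnd x : nondecreasing_seq (h^~ x).
  by move=> a b ab; have /lefP := nd_nnsfun_approx measurableT mEg ab; exact.
have Uh : radial_region g = \bigcup_k radial_region (h k).
  apply/seteqP; split => [x [x0 xg]|x [k _ [x0 xh]]].
    have [k] : exists k, ((enorm x ^+ m)%:E < (h k (radial_proj x))%:E)%E.
      have /(cvg_lim (@ereal_hausdorff R)) hl := hg (radial_proj x).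
      apply: contrapT => /forallNP hx; move: xg; rewrite -lte_fin -hl ltNge.
      move/negP; apply; apply: lime_le.
        by apply/cvg_ex; exists (g (radial_proj x))%:E; exact: hg.
      by apply: nearW => k /=; rewrite leNgt; apply/negP; exact: hx.
    by rewrite lte_fin => xk; exists k.
  split => //; apply: (lt_le_trans xh).
  have /(cvg_lim (@ereal_hausdorff R)) hl := hg (radial_proj x).
  rewrite -lee_fin -hl; apply: lime_ge.
    by apply/cvg_ex; exists (g (radial_proj x))%:E; exact: hg.
  by near=> j; rewrite /= lee_fin; apply: hnd; near: j; exact: nbhs_infty_ge.
rewrite (@nd_ge0_integral_lim _ _ _ _ _ h)//.
apply/cvg_lim => //.
rewrite Uh (_ : _ \o _ = mu \o (fun k => radial_region (h k))); last first.
  by apply/funext => k /=; rewrite mu_radial_region_nnsfun.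
apply: nondecreasing_cvg_mu.
- by move=> k; exact: measurable_radial_region.
- by apply: bigcup_measurable => k _; exact: measurable_radial_region.
- move=> a b ab; apply/subsetPset => x [x0 xa]; split => //.
  by apply: (lt_le_trans xa); exact: hnd.
Unshelve. all: by end_near. Qed.

End polar.

(** * Geometry of star bodies *)

Section star_body_geometry.
Context {R : realType} {n : nat} (K : set 'rV[R]_n).
Hypothesis starK : star_body K.
Local Notation p := (minkowski_functional K).

Let dilations (x : 'rV[R]_n) : set R :=
  [set a : R | 0 <= a /\ exists2 y, K y & x = a *: y].

Lemma star_body_supball : exists2 d : R, 0 < d & ball (0 : 'rV[R]_n) d `<=` K.
Proof.
by have [_ _ _ /nbhs_ballP[d /= d0 dK] _] := starK; exists d.
Qed.

Lemma star_body_bounded : exists2 M : R, 0 < M & forall y, K y -> `|y| <= M.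
Proof.
have [_ [M [_ KM]] _ _ _] := starK; exists (Num.max M 0 + 1).
  by rewrite ltr_wpDl// le_max lexx orbT.
by apply: KM; rewrite (@le_lt_trans _ _ (Num.max M 0))// ?ltrDl// le_max lexx.
Qed.

Lemma star_body0 : K 0.
Proof.
by have [d d0] := star_body_supball; apply; exact: ballxx.
Qed.

Let dilations_lb x : lbound (dilations x) 0.
Proof. by move=> a []. Qed.

Let minkowski_le x a : dilations x a -> p x <= a.
Proof. by move=> xa; apply: ge_inf => //; exists 0; exact: dilations_lb. Qed.

Lemma minkowski_le_supnorm : exists2 C : R, 0 < C &
  forall x, p x <= C * `|x|.
Proof.
have [d d0 dK] := star_body_supball.
exists (2 / d); first by rewrite divr_gt0.
move=> x; have [->|x0] := eqVneq x 0.
  rewrite normr0 mulr0; apply: minkowski_le; split => //.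
  by exists 0; [exact: star_body0|rewrite scaler0].
have nx : 0 < `|x| by rewrite normr_gt0.
have a0 : 0 < 2 / d * `|x| by rewrite mulr_gt0 ?divr_gt0.
apply: minkowski_le; split; first exact: ltW.
exists ((2 / d * `|x|)^-1 *: x); last by rewrite scalerA divff ?scale1r// gt_eqF.
apply: dK; rewrite mx_norm_ball /ball_ /= sub0r normrN normrZ gtr0_norm ?invr_gt0//.
by rewrite invfM invf_div -mulrA mulVf ?gt_eqF// mulr1 ltr_pdivrMr// ltr_pMr// ltr1n.
Qed.

Let dilations_nonempty x : dilations x !=set0.
Proof.
have [d d0 dK] := star_body_supball.
have a0 : 0 < `|x| / d + 1 by rewrite ltr_wpDl// divr_ge0// ltW.
exists (`|x| / d + 1); split; first exact: ltW.
exists ((`|x| / d + 1)^-1 *: x); last by rewrite scalerA divff ?scale1r// gt_eqF.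
apply: dK; rewrite mx_norm_ball /ball_ /= sub0r normrN normrZ gtr0_norm ?invr_gt0//.
by rewrite mulrC ltr_pdivrMr// mulrDr mulrCA divff ?gt_eqF// !mulr1 ltrDl.
Qed.

Lemma minkowski_ge_supnorm : exists2 c : R, 0 < c & forall x, c * `|x| <= p x.
Proof.
have [M M0 KM] := star_body_bounded; exists M^-1; first by rewrite invr_gt0.
move=> x; apply: lb_le_inf; first exact: dilations_nonempty.
move=> a [a0 [y Ky ->]]; rewrite normrZ ger0_norm// mulrC ler_pdivrMr//.
by rewrite ler_wpM2l// KM.
Qed.

Lemma minkowski_ge0 x : 0 <= p x.
Proof.
have [c c0 cp] := minkowski_ge_supnorm; apply: le_trans (cp x).
by rewrite mulr_ge0// ltW.
Qed.

Lemma minkowski_gt0 x : x != 0 -> 0 < p x.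
Proof.
have [c c0 cp] := minkowski_ge_supnorm => x0; apply: lt_le_trans (cp x).
by rewrite mulr_gt0// normr_gt0.
Qed.

Lemma minkowskiZ (t : R) x : 0 < t -> p (t *: x) = t * p x.
Proof.
have le (s : R) z : 0 < s -> p (s *: z) <= s * p z.
  move=> s0; rewrite -ler_pdivrMl//; apply: lb_le_inf => [|a [a0 [y Ky zE]]].
    exact: dilations_nonempty.
  rewrite ler_pdivrMl//; apply: minkowski_le; split; first by rewrite mulr_ge0// ltW.
  by exists y => //; rewrite zE scalerA.
move=> t0; apply/eqP; rewrite eq_le le//= -ler_pdivlMl//.
apply: le_trans (le _ _ _); last by rewrite invr_gt0.
by rewrite scalerA mulVf ?scale1r// gt_eqF.
Qed.

(** The boundary point is given by the largest parameter up to [b] that belongs to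
    [K], which exists because [K] is closed. *)
Let boundary_between (u : 'rV[R]_n) (a b : R) : a < b ->
  K (a *: u) -> ~ K (b *: u) -> exists2 s, a <= s < b & boundary K (s *: u).
Proof.
move=> ab Ka Kb; have [clK _ _ _ _] := starK.
have cu : continuous (fun t : R => t *: u).
  by move=> t; apply: cvgZl; exact: cvg_id.
pose S : set R := [set t | a <= t <= b /\ K (t *: u)].
have Sa : S a by split => //; rewrite lexx ltW.
have ubS : ubound S b by move=> t [/andP[]].
have supS : has_sup S by split; [exists a|exists b].
pose s := sup S.
have as_ : a <= s by apply: ub_le_sup => //; exists b.
have sb : s <= b by apply: ge_sup => //; exists a.
have Ks : K (s *: u).
  apply: contrapT => nKs.
  have /cu/nbhs_ballP[e /= e0 eK] : nbhs (s *: u) (~` K).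
    by apply: open_nbhs_nbhs; split => //; exact: closed_openC.
  have [t St st] := sup_adherent e0 supS.
  apply: (eK t) St.2; rewrite /ball/= ger0_norm ?subr_ge0; first by rewrite ltrBlDl -ltrBlDr.
  by apply: ub_le_sup => //; exists b.
have {}sb : s < b.
  by rewrite lt_neqAle sb andbT; apply/eqP => sE; apply: Kb; rewrite -sE.
exists s; first by rewrite as_ sb.
split; first exact: subset_closure.
move=> /cu/nbhs_ballP[e /= e0 eK].
pose t := Num.min b (s + e / 2).
have st : s < t by rewrite lt_min sb ltrDl divr_gt0.
have : S t.
  split; first by rewrite (le_trans as_ (ltW st)) ge_min lexx.
  apply: eK; rewrite /ball/= distrC gtr0_norm ?subr_gt0// ltrBlDl.
  by rewrite gt_min ltrD2l ltr_pdivrMr// ltr_pMr// ltr1n orbT.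
by move=> /(ub_le_sup (ex_intro _ b ubS)); rewrite leNgt st.
Qed.

Let leaves (u : 'rV[R]_n) (a : R) : u != 0 -> exists2 b, a < b & ~ K (b *: u).
Proof.
move=> u0; have [M M0 KM] := star_body_bounded.
have nu : 0 < `|u| by rewrite normr_gt0.
exists (`|a| + M / `|u| + 1).
  rewrite -addrA; apply: (le_lt_trans (ler_norm a)).
  by rewrite ltrDl addr_gt0// divr_gt0.
move=> /KM; rewrite normrZ ger0_norm; last first.
  by rewrite !addr_ge0// divr_ge0 ?ltW.
rewrite !mulrDl divfK ?gt_eqF// mul1r leNgt => /negP; apply.
by rewrite addrAC ltrDr ltr_wpDl// mulr_ge0.
Qed.

(** A gap on a ray would produce a third boundary point on its line. *)
Lemma star_body_starshaped (y : 'rV[R]_n) (t : R) : K y -> 0 <= t <= 1 -> K (t *: y).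
Proof.
move=> Ky; rewrite le_eqVlt => /andP[/predU1P[<- _|t0]].
  by rewrite scale0r; exact: star_body0.
rewrite le_eqVlt => /predU1P[->|t1]; first by rewrite scale1r.
have [->|y0] := eqVneq y 0; first by rewrite scaler0; exact: star_body0.
apply: contrapT => nKt.
have Ny0 : - y != 0 by rewrite oppr_eq0.
have [b1 b11 nK1] := leaves 1 y0.
have [b2 b20 nK2] := leaves 0 Ny0.
have K0 (u : 'rV[R]_n) : K (0 *: u) by rewrite scale0r; exact: star_body0.
have [s1 /andP[s10 s1t] Bs1] := boundary_between t0 (K0 y) nKt.
have Ky1 : K (1 *: y) by rewrite scale1r.
have [s2 /andP[s21 _] Bs2] := boundary_between b11 Ky1 nK1.
have [s3 /andP[s30 _] Bs3] := boundary_between b20 (K0 (- y)) nK2.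
have [_ _ /(_ _ y0)[q [r [_ lineE]]] K00 _] := starK.
have nz s u : boundary K (s *: u) -> s != 0.
  by apply: contraPneq => ->; rewrite scale0r => -[].
have inl s : boundary K (s *: y) -> [set q; r] (s *: y).
  move=> Bs; rewrite -lineE; split; last first.
    move=> /eqP; rewrite scaler_eq0 (negbTE y0) orbF => /eqP s0.
    by move: (nz _ _ Bs); rewrite s0 eqxx.
  by split => //; exists s.
have same (s s' : R) z : s *: y = z -> s' *: y = z -> s = s'.
  move=> sz s'z; apply/eqP; rewrite -subr_eq0.
  have /eqP : (s - s') *: y = 0 by rewrite scalerBl sz s'z subrr.
  by rewrite scaler_eq0 (negbTE y0) orbF.
have s30' : 0 < s3 by rewrite lt_def s30 (nz _ _ Bs3).
have s10' : 0 < s1 by rewrite lt_def s10 (nz _ _ Bs1).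
move: Bs3; rewrite scalerN -scaleNr => /inl B3.
case: B3 => e3; case: (inl _ Bs1) => e1; case: (inl _ Bs2) => e2;
  first [have s12 := same _ _ _ e1 e2; lra | have s13 := same _ _ _ e1 e3; lra
        | have s23 := same _ _ _ e2 e3; lra].
Qed.

(** Where [p < 1] the point is a contraction of a point of [K]; the level
    [p = 1] follows because [K] is closed. *)
Lemma star_bodyP x : K x <-> p x <= 1.
Proof.
split => Kx.
  by apply: minkowski_le; split => //; exists x => //; rewrite scale1r.
have [clK _ _ _ _] := starK.
have lt1 z : p z < 1 -> K z.
  move=> z1; have [||a [a0 [y Ky ->]] a1] := @inf_adherent _ (dilations z) (1 - p z).
  - by rewrite subr_gt0.
  - by split; [exact: dilations_nonempty|exists 0; exact: dilations_lb].
  - by apply: star_body_starshaped => //; move: a1; rewrite addrCA subrr addr0 a0 => /ltW.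
refine (@closed_cvg R 'rV[R]_n (at_left (1 : R)) _ (fun t : R => t *: x) K clK _ x _).
- near=> t; apply: lt1; rewrite minkowskiZ; last by near: t; exact: nbhs_left_gt.
  apply: le_lt_trans (_ : t < 1); last by near: t; exact: nbhs_left_lt.
  by rewrite ler_piMr//; near: t; exact: nbhs_left_ge.
- rewrite -[X in _ --> X]scale1r; apply: cvg_at_left_filter.
  by apply: cvgZl; exact: cvg_id.
Unshelve. all: by end_near. Qed.

End star_body_geometry.

(** * Radial functions and volumes of star bodies *)

Section radial_function.
Context {R : realType} {n : nat} (K : set 'rV[R]_n).
Hypothesis starK : star_body K.
Local Notation p := (minkowski_functional K).

Lemma measurable_minkowski : measurable_fun setT p.
Proof. by have [_ _ _ _ cp] := starK; exact: continuous_measurable_rV. Qed.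

Lemma measurable_radial : measurable_fun setT (radial K).
Proof.
rewrite /radial; under eq_fun do rewrite -powR_inv1 ?minkowski_ge0//.
exact: (measurableT_comp (measurable_powR (-1)) measurable_minkowski).
Qed.

Lemma radial_ge0 x : 0 <= radial K x.
Proof. by rewrite invr_ge0 minkowski_ge0. Qed.

Lemma sphere_neq0 (x : 'rV[R]_n) : sphere x -> x != 0.
Proof. by rewrite /sphere/= -enorm_gt0 => ->. Qed.

Lemma radial_bounded : exists2 C : R, 0 <= C & forall x, sphere x -> radial K x <= C.
Proof.
have [c c0 cp] := minkowski_ge_supnorm starK.
exists (Num.sqrt n%:R / c); first by rewrite divr_ge0 ?sqrtr_ge0// ltW.
move=> x Sx; have x0 := sphere_neq0 Sx.
have := enorm_le_supnorm x; rewrite Sx => h.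
have q0 : 0 < Num.sqrt n%:R :> R.
  by rewrite lt_def sqrtr_ge0 andbT; apply: contraTneq h => ->; rewrite mul0r ler10.
rewrite /radial -[leRHS]invrK invf_div lef_pV2 ?posrE ?minkowski_gt0 ?divr_gt0//.
apply: le_trans (cp x); rewrite ler_pdivrMr// -mulrA ler_peMr ?(ltW c0)//.
by rewrite mulrC.
Qed.

Lemma continuous_radial : {within sphere, continuous (radial K)}.
Proof.
have [_ _ _ _ cp] := starK; apply: continuous_in_subspaceT => x /set_mem Sx.
by apply: continuousV; [rewrite gt_eqF// minkowski_gt0// sphere_neq0|exact: cp].
Qed.

End radial_function.

Lemma radial_le {R : realType} {n : nat} (K L : set 'rV[R]_n) x :
  star_body K -> star_body L -> L `<=` K -> sphere x -> radial L x <= radial K x.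
Proof.
move=> sK sL LK Sx; have x0 := sphere_neq0 Sx.
rewrite lef_pV2 ?posrE ?minkowski_gt0//.
have pL := minkowski_gt0 sL x0.
have /LK/(star_bodyP sK) : L ((minkowski_functional L x)^-1 *: x).
  by apply/(star_bodyP sL); rewrite minkowskiZ ?invr_gt0// mulVf// gt_eqF.
by rewrite minkowskiZ ?invr_gt0// ler_pdivrMl// mulr1.
Qed.

Lemma measurable_rV0 {R : realType} {n : nat} : measurable [set 0 : 'rV[R]_n].
Proof.
rewrite (_ : [set 0] = [set x | enorm x <= 0]); first exact: measurable_enorm_le.
by apply/seteqP; split => x /=; rewrite le_eqVlt ltNge enorm_ge0 orbF enorm_eq0 => /eqP.
Qed.

Section polar_star_body.
Context {R : realType} {n m : nat} (mu : {measure set 'rV[R]_n -> \bar R}).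
Hypothesis mu_hom : homogeneous_measure m mu.
Hypothesis m_gt0 : (0 < m)%N.
Hypothesis mu_ball : mu (unit_ball R n) = (ball_vol m)%:E.

(** The dilation by 2 fixes the origin and multiplies its finite measure by
    [2 ^ m]. *)
Lemma homogeneous_measure_set0 : mu [set 0] = 0%E.
Proof.
pose Z : set 'rV[R]_n := [set 0]; rewrite -/Z.
have mZ : measurable Z by exact: measurable_rV0.
have : (mu Z < +oo)%E.
  apply: (@le_lt_trans _ _ (mu (unit_ball R n))); last by rewrite mu_ball ltry.
  apply: le_measure; rewrite ?inE//; first exact: measurable_enorm_le.
  by move=> _ ->; rewrite /unit_ball /= enorm0.
have := mu_hom (@ltr0Sn R 1) mZ.
have -> : *:%R 2 @^-1` Z = Z.
  apply/seteqP; split => x /=; last by move=> ->; rewrite scaler0.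
  by move/eqP; rewrite scaler_eq0 pnatr_eq0/= => /eqP.
have : (0 <= mu Z)%E by [].
case: (mu Z) => [a| |]//; rewrite lee_fin => a0.
rewrite -EFinM => -[] aE _; congr EFin; apply/eqP; rewrite eq_le a0 andbT.
have : 1 < 2 ^+ m :> R by rewrite exprn_egt1 -?lt0n// ltr1n.
by move=> h; nra.
Qed.

Lemma star_body_measurable (K : set 'rV[R]_n) : star_body K -> measurable K.
Proof. by case=> cK *; exact: closed_measurable_rV. Qed.

(** The region omits the origin and the boundary of [K]; both are negligible by
    homogeneity. *)
Lemma star_body_radial_region K : star_body K ->
  mu K = mu (@radial_region R n m (fun x => radial K x ^+ m)).
Proof.
move=> sK; set U := radial_region _.
have mK := star_body_measurable sK.
have mU : measurable U.
  by apply: measurable_radial_region; apply: measurable_funX; exact: measurable_radial.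
have UE : U = [set x | x != 0 /\ minkowski_functional K x < 1].
  have aux (x : 'rV[R]_n) : x != 0 ->
      (enorm x ^+ m < radial K (radial_proj x) ^+ m) = (minkowski_functional K x < 1).
    move=> x0; have ex : 0 < enorm x by rewrite enorm_gt0.
    rewrite ltr_pXn2r ?nnegrE ?enorm_ge0 ?radial_ge0//.
    rewrite /radial /radial_proj minkowskiZ ?invr_gt0// invfM invrK.
    by rewrite ltr_pMr// invf_gt1 ?minkowski_gt0.
  apply/seteqP; split => x; rewrite /U /radial_region /=.
    by rewrite enorm_gt0 => -[x0]; rewrite aux.
  by rewrite enorm_gt0 => -[x0]; rewrite aux.
have m0 : measurable [set 0 : 'rV[R]_n] by exact: measurable_rV0.
apply/eqP; rewrite eq_le; apply/andP; split; last first.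
  by apply: le_measure; rewrite ?inE// UE => x /= [_ /ltW/(star_bodyP sK)].
have KE : K = (K `\` [set 0]) `|` [set 0].
  by rewrite setDKU// => _ ->; exact: star_body0.
rewrite {1}KE; apply: le_trans.
  by apply: measureU2 => //; exact: measurableD.
rewrite [X in (_ + X <= _)%E]homogeneous_measure_set0 adde0.
apply: (homogeneous_measure_le mu_hom) => //; first exact: measurableD.
move=> t /andP[t0 t1] x [Kx /eqP x0]; rewrite UE /=.
rewrite scaler_eq0 (negbTE x0) gt_eqF// minkowskiZ//; split => //.
apply: le_lt_trans t1; rewrite ler_piMr ?(ltW t0)//.
exact/(star_bodyP sK).
Qed.

Lemma star_body_volume_lty K : star_body K -> (mu K < +oo)%E.
Proof.
move=> sK; have [M M0 KM] := star_body_bounded sK.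
pose r := Num.sqrt n%:R * M + 1.
have r0 : 0 < r by rewrite /r ltr_wpDl// mulr_ge0 ?sqrtr_ge0// ltW.
have mr : measurable [set x : 'rV[R]_n | enorm x <= r] by exact: measurable_enorm_le.
apply: (@le_lt_trans _ _ (mu [set x | enorm x <= r])).
  apply: le_measure; rewrite ?inE//; first exact: star_body_measurable.
  move=> x Kx /=; rewrite (le_trans (enorm_le_supnorm x))//.
  by rewrite /r ler_wpDr// ler_wpM2l ?sqrtr_ge0// KM.
rewrite (mu_hom r0 mr) (_ : _ @^-1` _ = unit_ball R n) ?mu_ball -?EFinM ?ltry//.
by apply/seteqP; split => x; rewrite /unit_ball /= enormZ gtr0_norm// ger_pMr.
Qed.

(** In the applications [D] is the unit sphere of the subspace on which [mu]
    lives. *)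
Context (D : set 'rV[R]_n).
Hypothesis mD : measurable D.
Hypothesis D_full : solid_angle mu (~` D) = 0%E.
Local Notation S := (surface_measure m mu).

Lemma surface_measure_setT : S setT = (m%:R * ball_vol m)%:E.
Proof.
rewrite EFinM -mu_ball /surface_measure /= /mscale /=; congr (_ * _)%E.
rewrite /pushforward preimage_setT /mrestr setTI.
have m0 : measurable [set 0 : 'rV[R]_n] by exact: measurable_rV0.
rewrite -[RHS](_ : mu (punctured_ball `|` [set 0]) = _); last first.
  congr (mu _); apply/seteqP; split => x.
    by move=> [/andP[]//|->]; rewrite /unit_ball /= enorm0.
  move=> x1; have [->|x0] := eqVneq x 0; first by right.
  by left; rewrite /punctured_ball/= enorm_gt0 x0.
rewrite measureU//= ?homogeneous_measure_set0 ?adde0//.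
  exact: measurable_punctured_ball.
apply/seteqP; split => // x [/andP[x0 _] xE].
by move: x0; rewrite xE enorm0 ltxx.
Qed.

Lemma surface_measureC : S (~` D) = 0%E.
Proof.
rewrite /surface_measure /= /mscale /= -[X in (_ * X)%E]/(solid_angle mu (~` D)).
by rewrite D_full mule0.
Qed.

Lemma surface_measureD : S D = (m%:R * ball_vol m)%:E.
Proof.
rewrite -surface_measure_setT -(setvU D) measureU//; last by rewrite setICl.
  by rewrite [X in (X + _)%E]surface_measureC add0e.
exact: measurableC.
Qed.

Lemma integrable_sphere (f : 'rV[R]_n -> R) (C : R) : measurable_fun setT f ->
  (forall x, D x -> `|f x| <= C) -> S.-integrable D (EFin \o f).
Proof.
move=> mf fC; apply: measurable_bounded_integrable => //.
- by rewrite surface_measureD ltry.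
- exact: measurable_funS mf.
- exists C; split; first exact: num_real.
  by move=> M CM x Dx; apply: (le_trans (fC x Dx)); exact: ltW.
Qed.

Lemma polar_volume K : star_body K ->
  \int[S]_(t in D) (radial K t ^+ m) = m%:R * fine (mu K).
Proof.
move=> sK; have mr : measurable_fun setT (fun x => radial K x ^+ m).
  by apply: measurable_funX; exact: measurable_radial.
have r0 x : 0 <= radial K x ^+ m by rewrite exprn_ge0// radial_ge0.
rewrite -[m%:R]/(fine m%:R%:E) -fineM//; last first.
  by rewrite ge0_fin_numE// star_body_volume_lty.
rewrite star_body_radial_region// -polar_coordinates//; congr fine.
rewrite [RHS](@ge0_negligible_integral _ _ _ _ _ (~` D))//.
- by rewrite setTD setCK.
- exact: measurableC.
- exact/measurable_EFinP.
- by move=> x _; rewrite lee_fin.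
- exact: surface_measureC.
Qed.

End polar_star_body.

(** * The whole space and its sections *)

Section space_and_sections.
Context {R : realType} {n : nat}.

Lemma measurable_sphere : measurable (@sphere R n).
Proof.
rewrite (_ : sphere = enorm @^-1` [set 1])//.
by rewrite -[X in measurable X]setTI; exact: measurable_enorm.
Qed.

Lemma sphere_radial_proj (x : 'rV[R]_n) : punctured_ball x -> sphere (radial_proj x).
Proof.
move=> /andP[x0 _]; rewrite /sphere /radial_proj /= enormZ.
by rewrite gtr0_norm ?invr_gt0// mulVf// gt_eqF.
Qed.

Lemma solid_angle_sphere (mu : {measure set 'rV[R]_n -> \bar R}) :
  solid_angle mu (~` sphere) = 0%E.
Proof.
rewrite solid_angleE (_ : _ `&` _ = set0) ?measure0//.
by apply/seteqP; split => // x [/= h /sphere_radial_proj].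
Qed.

Lemma sphere_measure_sphere : (0 < n)%N ->
  @sphere_measure R n sphere = (n%:R * ball_vol n)%:E.
Proof.
move=> n0; apply: surface_measureD => //.
- exact: lebesgue_rV_homogeneous.
- exact: lebesgue_rV_unit_ball.
- exact: measurable_sphere.
- exact: solid_angle_sphere.
Qed.

Lemma sphere_measure_setT : (0 < n)%N ->
  @sphere_measure R n setT = (n%:R * ball_vol n)%:E.
Proof.
move=> n0; apply: surface_measure_setT => //.
- exact: lebesgue_rV_homogeneous.
- exact: lebesgue_rV_unit_ball.
Qed.

Lemma volume_radial (K : set 'rV[R]_n) : (0 < n)%N -> star_body K ->
  \int[sphere_measure]_(t in sphere) (radial K t ^+ n) = n%:R * vol K.
Proof.
move=> n0 sK; apply: polar_volume => //.
- exact: lebesgue_rV_homogeneous.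
- exact: lebesgue_rV_unit_ball.
- exact: measurable_sphere.
- exact: solid_angle_sphere.
Qed.

Lemma integrable_sphere_measure (f : 'rV[R]_n -> R) (C : R) : (0 < n)%N ->
  measurable_fun setT f -> (forall x, sphere x -> `|f x| <= C) ->
  (@sphere_measure R n).-integrable sphere (EFin \o f).
Proof.
move=> n0 mf fC; apply: (integrable_sphere _ _ _ _ _ mf fC) => //.
- exact: lebesgue_rV_homogeneous.
- exact: lebesgue_rV_unit_ball.
- exact: measurable_sphere.
- exact: solid_angle_sphere.
Qed.

Context {k : nat} (F : Gr R n k).

Lemma enorm_frame (u : 'rV[R]_(n - k)) : enorm (u *m frame F) = enorm u.
Proof.
have dot j (v : 'rV[R]_j) : \sum_i v ord0 i ^+ 2 = (v *m v^T) 0 0.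
  by rewrite [RHS]mxE; apply: eq_bigr => i _; rewrite [v^T _ _]mxE expr2.
have [AA _] := frameP F.
by rewrite /enorm !dot trmx_mul mulmxA -(mulmxA u) AA mulmx1.
Qed.

Lemma frame_in_Gr (u : 'rV[R]_(n - k)) : Gr_set F (u *m frame F).
Proof. by rewrite /Gr_set /= (frameP F).2 submxMl. Qed.

Lemma measurable_Gr_set : measurable (Gr_set F).
Proof.
rewrite (_ : Gr_set F = mulmxr (cokermx (frame F)) @^-1` [set 0]).
  rewrite -[X in measurable X]setTI; apply: measurable_mulmx => //.
  exact: measurable_rV0.
apply/seteqP; split => x; rewrite /Gr_set /= (frameP F).2 submxE; first by move/eqP.
by move=> ->.
Qed.

Lemma lebesgue_GrE A : lebesgue_Gr F A =
  lebesgue_rV (n - k) ((fun u => u *m frame F) @^-1` A).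
Proof. by []. Qed.

Lemma lebesgue_Gr_homogeneous : homogeneous_measure (n - k) (lebesgue_Gr F).
Proof.
move=> t A t0 mA; rewrite !lebesgue_GrE.
rewrite (@lebesgue_rV_homogeneous _ _ t)//; last first.
  by rewrite -[X in measurable X]setTI; exact: (measurable_mulmx (frame F)).
congr (_ * lebesgue_rV _ _)%E.
by apply/seteqP; split => u /=; rewrite scalemxAl.
Qed.

Lemma lebesgue_Gr_unit_ball : lebesgue_Gr F (unit_ball R n) = (ball_vol (n - k))%:E.
Proof.
rewrite lebesgue_GrE -lebesgue_rV_unit_ball; congr (lebesgue_rV _ _).
by apply/seteqP; split => u; rewrite /unit_ball /= enorm_frame.
Qed.

Lemma solid_angle_Gr : solid_angle (lebesgue_Gr F) (~` (sphere `&` Gr_set F)) = 0%E.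
Proof.
rewrite solid_angleE lebesgue_GrE (_ : _ @^-1` _ = set0) ?measure0//.
apply/seteqP; split => // u [/= h uB]; apply: h; split.
  exact: sphere_radial_proj.
by rewrite /radial_proj scalemxAl; exact: frame_in_Gr.
Qed.

Lemma measurable_sphere_Gr : measurable (sphere `&` Gr_set F).
Proof. by apply: measurableI; [exact: measurable_sphere|exact: measurable_Gr_set]. Qed.

Hypothesis kn : (k < n)%N.
Let nk0 : (0 < n - k)%N. Proof. by rewrite subn_gt0. Qed.

Lemma integrable_sphere_Gr (f : 'rV[R]_n -> R) (C : R) :
  measurable_fun setT f -> (forall x, sphere x -> `|f x| <= C) ->
  (sphere_measure_Gr F).-integrable (sphere `&` Gr_set F) (EFin \o f).
Proof.
move=> mf fC; apply: (@integrable_sphere _ _ _ _ lebesgue_Gr_homogeneous nk0 lebesgue_Gr_unit_ball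
  _ measurable_sphere_Gr solid_angle_Gr _ C mf).
by move=> x [Sx _]; exact: fC.
Qed.

Lemma radon_cst (c : R) : radon (fun=> c) F = c * ((n - k)%:R * ball_vol (n - k)).
Proof.
rewrite /radon Rintegral_cst; last exact: measurable_sphere_Gr.
rewrite (@surface_measureD _ _ _ _ lebesgue_Gr_homogeneous nk0 lebesgue_Gr_unit_ball
  _ measurable_sphere_Gr solid_angle_Gr)//.
Qed.

(** Polar coordinates in the subspace [F]. *)
Lemma radon_radial (K : set 'rV[R]_n) : star_body K ->
  radon (fun t => radial K t ^+ (n - k)) F = (n - k)%:R * section_vol K F.
Proof.
move=> sK; rewrite /radon (@polar_volume _ _ _ _ lebesgue_Gr_homogeneous nk0 lebesgue_Gr_unit_ball
  _ measurable_sphere_Gr solid_angle_Gr)//.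
rewrite /section_vol; congr (_ * fine _); rewrite !lebesgue_GrE.
congr (lebesgue_rV _ _); apply/seteqP; split => u /=; last by case.
by move=> Ku; split => //; exact: frame_in_Gr.
Qed.

Lemma section_vol_le (K L : set 'rV[R]_n) : star_body K -> star_body L ->
  L `<=` K -> section_vol L F <= section_vol K F.
Proof.
move=> sK sL LK; have mG := measurable_Gr_set.
have mKG (M : set 'rV[R]_n) : star_body M -> measurable (M `&` Gr_set F).
  by move=> sM; apply: measurableI => //; exact: star_body_measurable.
have fin (M : set 'rV[R]_n) : star_body M -> (lebesgue_Gr F (M `&` Gr_set F) < +oo)%E.
  move=> sM; apply: (@le_lt_trans _ _ (lebesgue_Gr F M)).
    apply: le_measure; rewrite ?inE; [exact: mKG|exact: star_body_measurable|].
    exact: subIsetl.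
  exact: (star_body_volume_lty lebesgue_Gr_homogeneous lebesgue_Gr_unit_ball).
rewrite /section_vol fine_le ?ge0_fin_numE ?fin//.
apply: le_measure; rewrite ?inE; [exact: mKG|exact: mKG|exact: setSI].
Qed.

End space_and_sections.

Section volume.
Context {R : realType} {n : nat}.
Implicit Types K L : set 'rV[R]_n.

Lemma vol_fin K : star_body K -> lebesgue_rV n K = (vol K)%:E.
Proof.
move=> sK; rewrite /vol fineK// ge0_fin_numE//.
exact: (star_body_volume_lty (@lebesgue_rV_homogeneous R n) (lebesgue_rV_unit_ball n)).
Qed.

Lemma lebesgue_rV_supball_gt0 (a : 'rV[R]_n) (r : R) : 0 < r ->
  (0 < lebesgue_rV n (ball a r))%E.
Proof.
by move=> r0; rewrite lebesgue_rV_supball// lte_fin exprn_gt0// mulrn_wgt0.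
Qed.

Lemma vol_gt0 K : star_body K -> 0 < vol K.
Proof.
move=> sK; rewrite -lte_fin -vol_fin//; have [d d0 dK] := star_body_supball sK.
apply: (lt_le_trans (lebesgue_rV_supball_gt0 0 d0)).
apply: le_measure; rewrite ?inE//; first exact: measurable_ball_rV.
exact: star_body_measurable.
Qed.

Lemma vol_le K L : star_body K -> star_body L -> L `<=` K -> vol L <= vol K.
Proof.
move=> sK sL LK; rewrite -lee_fin -!vol_fin//.
by apply: le_measure; rewrite ?inE//; exact: star_body_measurable.
Qed.

(** If [K] had a point outside [L], it would contain a small ball disjoint
    from [L]. *)
Lemma star_body_vol_inj K L : star_body K -> star_body L -> L `<=` K ->
  vol L = vol K -> L = K.
Proof.
move=> sK sL LK vLK; apply/seteqP; split => // x Kx; apply: contrapT => nLx.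
pose pL := minkowski_functional L; pose pK := minkowski_functional K.
have pL1 : 1 < pL x.
  by rewrite ltNge; apply/negP => /(star_bodyP sL).
have pL0 : 0 < pL x by exact: lt_trans pL1.
pose t := (1 + (pL x)^-1) / 2.
have pV : (pL x)^-1 < 1 by rewrite invf_lt1.
have pV0 : 0 < (pL x)^-1 by rewrite invr_gt0.
have t0 : 0 < t by rewrite /t; lra.
have t1 : t < 1 by rewrite /t; lra.
have tp : 1 < t * pL x.
  by rewrite -ltr_pdivrMr// mul1r /t; lra.
have pK1 : pK (t *: x) < 1.
  rewrite /pK minkowskiZ//; apply: le_lt_trans t1.
  by rewrite ler_piMr ?(ltW t0)//; exact/(star_bodyP sK).
have [_ _ _ _ cK] := sK; have [_ _ _ _ cL] := sL.
have : nbhs (t *: x) (K `\` L).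
  have oK : nbhs (t *: x) [set y | pK y < 1].
    exact: (cK (t *: x) [set z | z < 1] (lt_nbhsl pK1)).
  have oL : nbhs (t *: x) [set y | 1 < pL y].
    have pLt : 1 < minkowski_functional L (t *: x) by rewrite minkowskiZ.
    exact: (cL (t *: x) [set z | 1 < z] (lt_nbhsr pLt)).
  apply: filterS2 oK oL => y yK yL; split; first exact/(star_bodyP sK)/ltW.
  by move=> /(star_bodyP sL); apply/negP; rewrite -ltNge.
move=> /nbhs_ballP[e /= e0 eKL].
have mb : measurable (ball (t *: x) e) by exact: measurable_ball_rV.
have mK := star_body_measurable sK; have mL := star_body_measurable sL.
have : (lebesgue_rV n (L `|` ball (t *: x) e) <= lebesgue_rV n K)%E.
  apply: le_measure; rewrite ?inE//; first exact: measurableU.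
  by move=> y [/LK//|/eKL[]].
rewrite measureU//; last first.
  by apply/seteqP; split => // y [Ly /eKL[]].
apply/negP; rewrite -ltNge.
rewrite [X in (_ < X + _)%E]vol_fin// vol_fin// -vLK lteDl//.
exact: lebesgue_rV_supball_gt0.
Qed.

End volume.

(** * Scalar inequalities and integrals bounded from below *)

Section integral_bounds.
Context {R : realType}.

(** The integral of a nonnegative function is a supremum over the simple functions
    below it, which makes it monotone on arbitrary functions.  It will be applied
    to Radon transforms as functions on the Grassmannian. *)
Lemma ge0_le_integral_setT d (T : measurableType d) (mu : {measure set T -> \bar R})
    (f g : T -> \bar R) : (forall x, 0 <= f x)%E -> (forall x, f x <= g x)%E ->
  (\int[mu]_x f x <= \int[mu]_x g x)%E.
Proof.
move=> f0 fg; have g0 x : (0 <= g x)%E by exact: le_trans (fg x).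
rewrite !ge0_integralTE//; apply: ereal_sup_le => _ [h hf <-].
by exists h => // x; exact: le_trans (hf x) (fg x).
Qed.

Lemma Rintegral_ge_cst d (T : measurableType d)
    (mu : {finite_measure set T -> \bar R}) (f : T -> R) (c C : R) :
  0 <= c -> (forall x, c <= f x) -> (forall x, f x <= C) ->
  c * fine (mu setT) <= \int[mu]_x f x.
Proof.
move=> c0 cf fC; rewrite -Rintegral_cst// fine_le//.
- by rewrite integral_cst// fin_numM// fin_num_measure.
- have f0 x : (0 <= (f x)%:E)%E by rewrite lee_fin (le_trans c0).
  rewrite ge0_fin_numE ?integral_ge0//.
  apply: (@le_lt_trans _ _ (\int[mu]_x C%:E)%E).
    by apply: ge0_le_integral_setT => // x; rewrite lee_fin.
  by rewrite integral_cst// ltey_eq fin_numM// fin_num_measure.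
- by apply: ge0_le_integral_setT => x; rewrite lee_fin.
Qed.

End integral_bounds.

Section inequalities.
Context {R : realType}.

(** Young's inequality with the exponents [(k + l) / k] and [(k + l) / l]. *)
Lemma weighted_amgm (x y : R) (k l : nat) : (0 < k)%N -> (0 < l)%N ->
  0 <= x -> 0 <= y ->
  (k + l)%:R * (x ^+ k * y ^+ l) <= k%:R * x ^+ (k + l) + l%:R * y ^+ (k + l).
Proof.
move=> k0 l0 x0 y0.
have kR : 0 < k%:R :> R by rewrite ltr0n.
have lR : 0 < l%:R :> R by rewrite ltr0n.
have nR : 0 < (k + l)%:R :> R by rewrite ltr0n addn_gt0 k0.
have pw (z : R) j : 0 <= z -> (0 < j)%N -> (z ^+ j) `^ ((k + l)%:R / j%:R) = z ^+ (k + l).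
  move=> z0 j0; rewrite -powR_mulrn// -powRrM mulrC divfK ?pnatr_eq0 -?lt0n//.
  by rewrite powR_mulrn.
have := @conjugate_powR R (x ^+ k) (y ^+ l) ((k + l)%:R / k%:R) ((k + l)%:R / l%:R).
rewrite !exprn_ge0// !divr_gt0// !pw// !invf_div -mulrDl -natrD divff ?gt_eqF//.
move=> /(_ isT isT isT isT erefl) h.
rewrite mulrC -ler_pdivlMr//; apply: (le_trans h).
by rewrite mulrDl !mulrA [_ * k%:R]mulrC [_ * l%:R]mulrC.
Qed.

(** The convex function [t ^- k] lies above its tangent line at [s].  For
    [v = s / t] this is Bernoulli's inequality, weakened by [v + v^-1 >= 2]. *)
Lemma inv_pow_tangent (s t : R) (k : nat) : 0 < s -> 0 < t ->
  s ^- k * (1 - k%:R * (t / s - 1)) <= t ^- k.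
Proof.
move=> s0 t0; rewrite -ler_pdivlMl ?invr_gt0 ?exprn_gt0// invrK -expr_div_n.
have v0 : 0 < s / t by rewrite divr_gt0.
apply: (@le_trans _ _ (1 + k%:R * (s / t - 1))).
  rewrite lerD2l -mulrN ler_wpM2l// opprB.
  have st : (s / t) * (t / s) = 1 by rewrite mulrA divfK ?divff// gt_eqF.
  have u0 : 0 < t / s by rewrite divr_gt0.
  move: st v0 u0; set v := s / t; set u := t / s => uv v0 u0.
  have := sqr_ge0 (v - u) => h; nra.
exact: bernoulli_ineq (ltW v0).
Qed.

End inequalities.

(** * Dual mixed volumes and means on the sphere *)

Section dual_mixed_volumes.
Context {R : realType} {n : nat}.
Hypothesis n0 : (0 < n)%N.
Implicit Types A B K L D : set 'rV[R]_n.
Local Notation S := (@sphere_measure R n).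
Let mS : measurable (@sphere R n) := measurable_sphere.

Lemma measurable_radial_mixed A B i j : star_body A -> star_body B ->
  measurable_fun setT (fun t => radial A t ^+ i * radial B t ^+ j).
Proof.
by move=> sA sB; apply: measurable_funM; apply: measurable_funX; exact: measurable_radial.
Qed.

Lemma radial_mixed_bounded A B i j : star_body A -> star_body B ->
  exists C : R, forall t, sphere t -> `|radial A t ^+ i * radial B t ^+ j| <= C.
Proof.
move=> sA sB; have [a a0 Aa] := radial_bounded sA; have [b b0 Bb] := radial_bounded sB.
exists (a ^+ i * b ^+ j) => t St.
rewrite ger0_norm ?mulr_ge0 ?exprn_ge0 ?radial_ge0//.
by rewrite ler_pM ?exprn_ge0 ?radial_ge0// lerXn2r ?nnegrE ?radial_ge0 ?Aa ?Bb.
Qed.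

Lemma integrable_radial_mixed A B i j : star_body A -> star_body B ->
  S.-integrable sphere (EFin \o (fun t => radial A t ^+ i * radial B t ^+ j)).
Proof.
move=> sA sB; have [C HC] := radial_mixed_bounded i j sA sB.
exact: integrable_sphere_measure (measurable_radial_mixed _ _ _ _) HC.
Qed.

Lemma integrable_radial_pow A i : star_body A ->
  S.-integrable sphere (EFin \o (fun t => radial A t ^+ i)).
Proof.
move=> sA; have := integrable_radial_mixed i 0 sA sA.
by apply: eq_integrable => // t _; rewrite /= expr0 mulr1.
Qed.

Lemma integrable_minkowski A : star_body A ->
  S.-integrable sphere (EFin \o minkowski_functional A).
Proof.
move=> sA; have [C C0 HC] := minkowski_le_supnorm sA.
apply: (@integrable_sphere_measure _ _ _ C) => //; first exact: measurable_minkowski.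
move=> x Sx; rewrite ger0_norm ?minkowski_ge0// (le_trans (HC x))//.
by rewrite ler_piMr ?(ltW C0)// -Sx supnorm_le_enorm.
Qed.

(** Hoelder's inequality for the dual mixed volume of two star bodies: integrate
    the weighted inequality between arithmetic and geometric means for the radial
    functions of the two bodies normalized to volume 1. *)
Lemma dual_mixed_volume_le K L k : (0 < k)%N -> (k < n)%N -> star_body K -> star_body L ->
  \int[S]_(t in sphere) (radial L t ^+ k * radial K t ^+ (n - k)) <=
  n%:R * (vol L `^ (k%:R / n%:R) * vol K `^ ((n - k)%:R / n%:R)).
Proof.
move=> k0 kn sK sL; have vK := vol_gt0 sK; have vL := vol_gt0 sL.
have nR : n%:R != 0 :> R by rewrite pnatr_eq0 -lt0n.
pose a := vol L `^ n%:R^-1; pose b := vol K `^ n%:R^-1.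
have a0 : 0 < a by exact: powR_gt0.
have b0 : 0 < b by exact: powR_gt0.
have pw (v : R) j : v `^ (j%:R / n%:R) = (v `^ n%:R^-1) ^+ j.
  by rewrite mulrC powRrM powR_mulrn ?powR_ge0.
have an : a ^+ n = vol L by rewrite -pw divff// powRr1// ltW.
have bn : b ^+ n = vol K by rewrite -pw divff// powRr1// ltW.
rewrite !pw -/a -/b.
have nE : (k + (n - k))%N = n by rewrite subnKC// ltnW.
pose c1 := k%:R / n%:R * (a ^+ k * b ^+ (n - k)) / vol L.
pose c2 := (n - k)%:R / n%:R * (a ^+ k * b ^+ (n - k)) / vol K.
have iL := integrable_radial_pow n sL; have iK := integrable_radial_pow n sK.
have iZ c A : star_body A -> S.-integrable sphere (EFin \o (fun t => c * radial A t ^+ n)).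
  move=> sA; have := integrableZl mS c (integrable_radial_pow n sA).
  by apply: eq_integrable => // t _; rewrite /= EFinM.
apply: (@le_trans _ _ (\int[S]_(t in sphere) (c1 * radial L t ^+ n + c2 * radial K t ^+ n))).
  apply: le_Rintegral => //; first exact: integrable_radial_mixed.
    have := integrableD mS (iZ c1 _ sL) (iZ c2 _ sK).
    by apply: eq_integrable => // t _; rewrite /= EFinD.
  move=> t St.
  have nk0 : (0 < n - k)%N by rewrite subn_gt0.
  have x0 : 0 <= radial L t / a by rewrite divr_ge0 ?radial_ge0 ?ltW.
  have y0 : 0 <= radial K t / b by rewrite divr_ge0 ?radial_ge0 ?ltW.
  have := weighted_amgm k0 nk0 x0 y0; rewrite nE !expr_div_n an bn.
  have ak : 0 < a ^+ k by rewrite exprn_gt0.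
  have bk : 0 < b ^+ (n - k) by rewrite exprn_gt0.
  rewrite -(@ler_pM2r _ (a ^+ k * b ^+ (n - k) / n%:R)); last first.
    by rewrite divr_gt0 ?mulr_gt0// ltr0n.
  rewrite [leLHS](_ : _ = radial L t ^+ k * radial K t ^+ (n - k)); last first.
    by field; rewrite nR !gt_eqF.
  rewrite [leRHS](_ : _ = c1 * radial L t ^+ n + c2 * radial K t ^+ n)//.
  by rewrite /c1 /c2; field; rewrite nR !gt_eqF.
rewrite RintegralD//; [|exact: iZ|exact: iZ].
rewrite !RintegralZl// !volume_radial//.
rewrite le_eqVlt; apply/orP; left; apply/eqP.
rewrite /c1 /c2 natrB ?(ltnW kn)//; field.
by rewrite nR !gt_eqF.
Qed.

Lemma sphere_prob_integral (f : 'rV[R]_n -> R) : measurable_fun setT f ->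
  (forall x, 0 <= f x) ->
  S.-integrable sphere (EFin \o f) ->
  \int[sphere_prob]_(t in sphere) f t =
  (n%:R * ball_vol n)^-1 * \int[S]_(t in sphere) f t.
Proof.
move=> mf f0 fi; have c0 : 0 < n%:R * ball_vol n :> R.
  by rewrite mulr_gt0 ?ltr0n// ball_vol_gt0.
have cV : 0 <= (n%:R * ball_vol n)^-1 :> R by rewrite invr_ge0 ltW.
rewrite /Rintegral.
have -> : (\int[sphere_prob]_(t in sphere) (f t)%:E =
    \int[mscale (NngNum cV) S]_(t in sphere) (f t)%:E)%E.
  apply: eq_measure_integral => A mA _; have ST := @sphere_measure_setT R n n0.
  rewrite /sphere_prob /= /mnormalize ST eqe gt_eqF//=.
  by rewrite /mscale /= muleC.
rewrite ge0_integral_mscale//; last by move=> x _; rewrite lee_fin.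
  by rewrite fineM//; exact: integrable_fin_num.
by apply/measurable_EFinP; exact: measurable_funS mf.
Qed.

Lemma radial_power_meanE K k : star_body K ->
  radial_power_mean k K =
  (n%:R * ball_vol n)^-1 * \int[S]_(t in sphere) radial K t ^+ k.
Proof.
move=> sK; rewrite /radial_power_mean -sphere_prob_integral//.
- by apply: eq_Rintegral => t _; rewrite exprVn.
- by apply: measurable_funX; exact: measurable_radial.
- by move=> x; rewrite exprn_ge0// radial_ge0.
- exact: integrable_radial_pow.
Qed.

Lemma mean_functionalE K : star_body K ->
  mean_functional K =
  (n%:R * ball_vol n)^-1 * \int[S]_(t in sphere) minkowski_functional K t.
Proof.
move=> sK; rewrite /mean_functional sphere_prob_integral//.
- exact: measurable_minkowski.
- by move=> x; exact: minkowski_ge0.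
- exact: integrable_minkowski.
Qed.

Lemma mean_functional_gt0 K : star_body K -> 0 < mean_functional K.
Proof.
move=> sK; have c0 : 0 < n%:R * ball_vol n :> R.
  by rewrite mulr_gt0 ?ltr0n// ball_vol_gt0.
rewrite mean_functionalE// mulr_gt0 ?invr_gt0//.
have [c cc cp] := minkowski_ge_supnorm sK.
have q0 : 0 < Num.sqrt n%:R :> R by rewrite sqrtr_gt0 ltr0n.
have d0 : 0 < c / Num.sqrt n%:R by rewrite divr_gt0.
apply: (@lt_le_trans _ _ (\int[S]_(t in sphere) (c / Num.sqrt n%:R))).
  by rewrite Rintegral_cst// [X in fine X]sphere_measure_sphere// mulr_gt0.
apply: le_Rintegral => //.
- apply: (@integrable_sphere_measure _ _ _ (c / Num.sqrt n%:R)) => //.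
  by move=> x _; rewrite ger0_norm// ltW.
- exact: integrable_minkowski.
- move=> x Sx; apply: le_trans (cp x); rewrite ler_pdivrMr// -mulrA ler_peMr ?(ltW cc)//.
  by have := enorm_le_supnorm x; rewrite Sx mulrC.
Qed.

(** Jensen's inequality for [t ^- k]: integrate its tangent line at the mean. *)
Lemma radial_power_mean_ge K k : star_body K ->
  mean_functional K ^- k <= radial_power_mean k K.
Proof.
move=> sK; have M0 := mean_functional_gt0 sK; set M := mean_functional K in M0 *.
have c0 : 0 < n%:R * ball_vol n :> R.
  by rewrite mulr_gt0 ?ltr0n// ball_vol_gt0.
rewrite radial_power_meanE// ler_pdivlMl//.
(* the tangent line at [M] is [u - v * t] *)
pose u := M ^- k * (1 + k%:R); pose v := M ^- k * k%:R / M.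
have ip := integrable_minkowski sK.
have iu : S.-integrable sphere (EFin \o (fun=> u)).
  exact: (@integrable_sphere_measure _ _ _ `|u|).
have iv : S.-integrable sphere (EFin \o (fun t => v * minkowski_functional K t)).
  have := integrableZl mS v ip.
  by apply: eq_integrable => // t _; rewrite /= EFinM.
apply: (@le_trans _ _ (\int[S]_(t in sphere) (u - v * minkowski_functional K t))).
  rewrite RintegralB// Rintegral_cst// RintegralZl// [X in fine X]sphere_measure_sphere//=.
  have -> : \int[S]_(t in sphere) minkowski_functional K t = n%:R * ball_vol n * M.
    by rewrite /M mean_functionalE// mulrA divff ?mul1r// gt_eqF.
  rewrite /u /v le_eqVlt; apply/orP; left; apply/eqP.
  by field; rewrite expf_neq0 gt_eqF.
apply: le_Rintegral => //.
- have := integrableB mS iu iv.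
  by apply: eq_integrable => // t _; rewrite /= EFinB.
- exact: integrable_radial_pow.
- move=> t St; rewrite /radial exprVn.
  apply: le_trans (inv_pow_tangent k M0 (minkowski_gt0 sK (sphere_neq0 St))).
  rewrite /u /v le_eqVlt; apply/orP; left; apply/eqP.
  by field; rewrite expf_neq0 gt_eqF.
Qed.

Lemma mean_functional_normalize K : star_body K ->
  mean_functional (normalize K) = vol K `^ n%:R^-1 * mean_functional K.
Proof.
move=> sK; have s0 : 0 < vol K `^ n%:R^-1 by apply: powR_gt0; exact: vol_gt0.
have pE x : minkowski_functional (normalize K) x =
    vol K `^ n%:R^-1 * minkowski_functional K x.
  rewrite -minkowskiZ//; congr inf; apply/seteqP; split => a [a0 [y]].
    move=> [z Kz <-] ->; split => //; exists z => //.
    by rewrite !scalerA; congr (_ *: z); field; rewrite gt_eqF.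
  move=> Ky xE; split => //; exists ((vol K `^ n%:R^-1)^-1 *: y); first by exists y.
  by rewrite scalerA mulrC -scalerA -xE scalerA mulVf ?scale1r// gt_eqF.
have ip := integrable_minkowski sK.
rewrite (mean_functionalE sK) /mean_functional.
transitivity (\int[sphere_prob]_(t in sphere)
    (vol K `^ n%:R^-1 * minkowski_functional K t)).
  by apply: eq_Rintegral => t _; rewrite pE.
rewrite sphere_prob_integral//.
- by rewrite RintegralZl// mulrCA.
- by apply: measurable_funM => //; exact: measurable_minkowski.
- by move=> x; rewrite mulr_ge0 ?minkowski_ge0// ltW.
- have := integrableZl mS (vol K `^ n%:R^-1) ip.
  by apply: eq_integrable => // t _; rewrite /= EFinM.
Qed.

End dual_mixed_volumes.

(** * Comparison with generalized intersection bodies *)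

Section intersection_bodies.
Context {R : realType} {n k : nat}.
Hypothesis k0 : (0 < k)%N.
Hypothesis kn : (k < n)%N.
Implicit Types K L D : set 'rV[R]_n.
Local Notation S := (@sphere_measure R n).
Let n0 : (0 < n)%N. Proof. exact: leq_ltn_trans kn. Qed.
Let nk0 : (0 < n - k)%N. Proof. by rewrite subn_gt0. Qed.
Let mS : measurable (@sphere R n) := measurable_sphere.

Lemma continuous_radial_pow K i : star_body K ->
  {within sphere, continuous (fun t => radial K t ^+ i)}.
Proof.
move=> sK x; apply: (@continuous_comp _ _ _ (radial K : subspace sphere -> R) (fun y => y ^+ i)).
  exact: (continuous_radial sK).
exact: exprn_continuous.
Qed.

Lemma radial_pow_bounded K i : star_body K ->
  exists2 C : R, 0 <= C & forall x, sphere x -> `|radial K x ^+ i| <= C.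
Proof.
move=> sK; have [C C0 KC] := radial_bounded sK.
exists (C ^+ i); first exact: exprn_ge0.
move=> x Sx; rewrite ger0_norm ?exprn_ge0 ?radial_ge0//.
by rewrite lerXn2r ?nnegrE ?radial_ge0 ?KC.
Qed.

Lemma integrable_radial_Gr K i (F : Gr R n k) : star_body K ->
  (sphere_measure_Gr F).-integrable (sphere `&` Gr_set F)
    (EFin \o (fun t => radial K t ^+ i)).
Proof.
move=> sK; have [C _ KC] := radial_pow_bounded i sK.
apply: integrable_sphere_Gr KC => //.
by apply: measurable_funX; exact: measurable_radial.
Qed.

Lemma section_vol_bounded K : star_body K ->
  exists C : R, forall F : Gr R n k, section_vol K F <= C.
Proof.
move=> sK; have [C _ KC] := radial_pow_bounded (n - k) sK.
exists (C * ball_vol (n - k)) => F.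
have nkR : 0 < (n - k)%:R :> R by rewrite ltr0n.
rewrite -(ler_pM2l nkR) -radon_radial// mulrCA -(radon_cst F kn).
apply: le_Rintegral => //; first exact: measurable_sphere_Gr.
- exact: integrable_radial_Gr.
- exact: (@integrable_sphere_Gr _ _ _ _ kn _ `|C|).
- by move=> x [Sx _]; apply: le_trans (KC x Sx); exact: ler_norm.
Qed.

Lemma radon_radialB K L (F : Gr R n k) : star_body K -> star_body L ->
  radon (fun t => radial K t ^+ (n - k) - radial L t ^+ (n - k)) F =
  (n - k)%:R * (section_vol K F - section_vol L F).
Proof.
move=> sK sL; rewrite mulrBr -!radon_radial// /radon RintegralB//.
- exact: measurable_sphere_Gr.
- exact: integrable_radial_Gr.
- exact: integrable_radial_Gr.
Qed.

(** Integrating the section inequality against the measure that represents [D]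
    turns it into an inequality between dual mixed volumes. *)
Lemma section_gap_le K L D (e : R) : star_body K -> star_body L ->
  gen_intersection_body k D -> D `<=` L -> L `<=` K -> 0 <= e ->
  (forall F : Gr R n k, e <= section_vol K F - section_vol L F) ->
  e * \int[S]_(t in sphere) (radial D t ^+ k) <=
  ball_vol (n - k) * (n%:R * (vol L `^ (k%:R / n%:R) *
    (vol K `^ ((n - k)%:R / n%:R) - vol L `^ ((n - k)%:R / n%:R)))).
Proof.
move=> sK sL [sD _ [mu muD]] DL LK e0 eF.
have nkR : 0 < (n - k)%:R :> R by rewrite ltr0n.
have w0 : 0 < ball_vol (n - k) :> R by exact: ball_vol_gt0.
pose g t := radial K t ^+ (n - k) - radial L t ^+ (n - k).
have total : \int[S]_(t in sphere) (radial D t ^+ k) =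
    (n - k)%:R * ball_vol (n - k) * fine (mu setT).
  transitivity (\int[S]_(t in sphere) (radial D t ^+ k * 1)).
    by apply: eq_Rintegral => t _; rewrite mulr1.
  rewrite (muD (fun=> 1)); last by move=> x; exact: cst_continuous.
  under eq_Rintegral do rewrite radon_cst//.
  by rewrite mul1r Rintegral_cst.
have gap : (n - k)%:R * e * fine (mu setT) <=
    \int[S]_(t in sphere) (radial D t ^+ k * g t).
  rewrite (muD g); last first.
    move=> x; apply: cvgB; exact: continuous_radial_pow.
  have [C KC] := section_vol_bounded sK.
  have secL0 (F : Gr R n k) : 0 <= section_vol L F by rewrite fine_ge0.
  apply: (@Rintegral_ge_cst _ _ _ _ _ _ ((n - k)%:R * C)).
  - by rewrite mulr_ge0// ltW.
  - by move=> F; rewrite radon_radialB// ler_wpM2l// ltW.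
  - move=> F; rewrite radon_radialB// ler_wpM2l ?(ltW nkR)//.
    by rewrite lerBlDr (le_trans (KC F))// lerDl.
have upper : \int[S]_(t in sphere) (radial D t ^+ k * g t) <=
    n%:R * (vol L `^ (k%:R / n%:R) *
    (vol K `^ ((n - k)%:R / n%:R) - vol L `^ ((n - k)%:R / n%:R))).
  have iB A : star_body A -> S.-integrable sphere (EFin \o (fun t => radial A t ^+ k * g t)).
    move=> sA; have := integrableB mS (integrable_radial_mixed n0 k (n - k) sA sK)
      (integrable_radial_mixed n0 k (n - k) sA sL).
    by apply: eq_integrable => // t _; rewrite /= mulrBr EFinB.
  apply: (@le_trans _ _ (\int[S]_(t in sphere) (radial L t ^+ k * g t))).
    apply: le_Rintegral; rewrite ?iB// => t St; apply: ler_wpM2r.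
      by rewrite subr_ge0 lerXn2r ?nnegrE ?radial_ge0// radial_le.
    by rewrite lerXn2r ?nnegrE ?radial_ge0// radial_le.
  under eq_Rintegral do rewrite mulrBr.
  rewrite RintegralB//; [|exact: integrable_radial_mixed|exact: integrable_radial_mixed].
  rewrite mulrBr mulrBr lerB// ?dual_mixed_volume_le//.
  rewrite -powRD; last by rewrite (gt_eqF (vol_gt0 sL)) implybT.
  rewrite -mulrDl -natrD subnKC ?(ltnW kn)// divff ?pnatr_eq0 -?lt0n//.
  rewrite powRr1 ?(ltW (vol_gt0 sL))// -volume_radial//.
  under [leRHS]eq_Rintegral do rewrite -exprD subnKC ?(ltnW kn)//.
  by [].
rewrite total mulrCA -!mulrA [leLHS]mulrCA ler_wpM2l ?(ltW w0)//.
by apply: le_trans upper; apply: le_trans gap; rewrite -mulrA.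
Qed.

Lemma radial_power_mean_gt0 K : star_body K -> 0 < radial_power_mean k K.
Proof.
move=> sK; apply: lt_le_trans (radial_power_mean_ge n0 k sK).
by rewrite invr_gt0 exprn_gt0// mean_functional_gt0.
Qed.

(** [section_gap_le] divided by the mean of the [k]-th power of the radial
    function of [D].  The factor [vol L ^ (k / n)] cancels against the
    normalization of [L] in the mean functional. *)
Lemma radial_power_mean_ratio K L D (e : R) : star_body K -> star_body L ->
  gen_intersection_body k D -> D `<=` L -> L `<=` K -> 0 <= e ->
  (forall F : Gr R n k, e <= section_vol K F - section_vol L F) ->
  2^-1 ^+ k * (Num.sqrt n%:R * mean_functional (normalize L)) ^- k * e <=
  radial_power_mean k L / radial_power_mean k D *
  (vol K `^ ((n - k)%:R / n%:R) - vol L `^ ((n - k)%:R / n%:R)).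
Proof.
move=> sK sL gD DL LK e0 eF; have [sD _ _] := gD.
have Q0 := radial_power_mean_gt0 sD.
have := section_gap_le sK sL gD DL LK e0 eF.
set V := vol K `^ _ - _.
have V0 : 0 <= V.
  rewrite subr_ge0 ge0_ler_powR ?nnegrE ?divr_ge0 ?(ltW (vol_gt0 _))//.
  exact: vol_le.
have nR : 0 < n%:R :> R by rewrite ltr0n.
have wn : 0 < ball_vol n :> R by exact: ball_vol_gt0.
have w' : 0 < ball_vol (n - k) :> R by exact: ball_vol_gt0.
have -> : \int[S]_(t in sphere) (radial D t ^+ k) =
    n%:R * ball_vol n * radial_power_mean k D.
  by rewrite radial_power_meanE// mulrA divff ?mul1r// gt_eqF// mulr_gt0.
have M0 := mean_functional_gt0 n0 sL.
rewrite mean_functional_normalize//.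
have a0 : 0 < vol L `^ n%:R^-1 by apply: powR_gt0; exact: vol_gt0.
have -> : vol L `^ (k%:R / n%:R) = (vol L `^ n%:R^-1) ^+ k.
  by rewrite mulrC powRrM powR_mulrn ?powR_ge0.
have := radial_power_mean_ge n0 k sL.
have := @ball_vol_ratio R (n - k) k; rewrite subnK ?(ltnW kn)//.
have q0 : 0 < Num.sqrt n%:R :> R by rewrite sqrtr_gt0.
move=> wv MP h; rewrite [_ / _ * V]mulrAC ler_pdivlMr//; move: wv MP h.
move: Q0 V0 nR wn w' M0 a0 q0.
set Q := radial_power_mean k D; set P := radial_power_mean k L.
set w := ball_vol n; set v := ball_vol (n - k); set M := mean_functional L.
set a := vol L `^ _; set q := Num.sqrt _.
move=> Q0 V0 nR wn w' M0 a0 q0 wv MP h.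
apply: (@le_trans _ _ (M ^- k * V)); last by rewrite ler_wpM2r.
pose h0 : R := (2^-1 / q) ^+ k.
have h00 : 0 < h0 by rewrite exprn_gt0// divr_gt0.
have Mk : 0 < M ^- k by rewrite invr_gt0 exprn_gt0.
have ak : 0 < a ^+ k by rewrite exprn_gt0.
have -> : 2^-1 ^+ k * (q * (a * M)) ^- k * e * Q =
    M ^- k * (h0 * (e * Q) / a ^+ k).
  rewrite /h0 !exprMn !exprVn; field.
  by rewrite !expf_neq0 ?pnatr_eq0 ?gt_eqF.
rewrite ler_pM2l// ler_pdivrMr// -(ler_pM2l wn) -(ler_pM2l nR).
have {}h : h0 * (e * (n%:R * w * Q)) <= h0 * (v * (n%:R * (a ^+ k * V))).
  by rewrite ler_pM2l.
have -> : n%:R * (w * (h0 * (e * Q))) = h0 * (e * (n%:R * w * Q)) by ring.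
apply: (le_trans h).
have -> : h0 * (v * (n%:R * (a ^+ k * V))) = (h0 * v) * (n%:R * (V * a ^+ k)) by ring.
have -> : n%:R * (w * (V * a ^+ k)) = w * (n%:R * (V * a ^+ k)) by ring.
by rewrite ler_wpM2r// mulr_ge0 ?(ltW nR)// mulr_ge0// ltW.
Qed.

End intersection_bodies.

Section extended_power.
Context {R : realType}.

Lemma lee_expe (x y : \bar R) k : (0 <= x)%E -> (x <= y)%E -> (x ^+ k <= y ^+ k)%E.
Proof.
move=> x0 xy; elim: k => [|k IH]; first by [].
by rewrite !expeS lee_pmul// expe_ge0.
Qed.

End extended_power.

Theorem theorem1p6 (R : realType) :
  exists2 c : R, 0 < c &
  forall (n k : nat) (K L : set 'rV[R]_n),
    (1 <= k)%N -> (k < n)%N ->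
    star_body K -> origin_symmetric K ->
    star_body L -> origin_symmetric L ->
    L `<=` K ->
    ((c ^+ k * (Num.sqrt n%:R * mean_functional (normalize L)) ^- k *
        inf (range (fun F : Gr R n k => section_vol K F - section_vol L F)))%:E
     <= dist_BP k L ^+ k *
        (vol K `^ ((n - k)%:R / n%:R) - vol L `^ ((n - k)%:R / n%:R))%:E)%E.
Proof.
exists 2^-1 => // n k K L k0 kn sK _ sL _ LK.
have n0 : (0 < n)%N by exact: leq_ltn_trans kn.
set e := inf _; set V := vol K `^ _ - _.
have gap0 (F : Gr R n k) : 0 <= section_vol K F - section_vol L F.
  by rewrite subr_ge0 section_vol_le.
have eF (F : Gr R n k) : e <= section_vol K F - section_vol L F.
  by apply: ge_inf; [exists 0 => _ [G _ <-]|exists F].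
have e0 : 0 <= e.
  apply: lb_le_inf; last by move=> _ [F _ <-].
  by exists (section_vol K (point : Gr R n k) - section_vol L (point : Gr R n k)); exists point.
have M0 : 0 < Num.sqrt n%:R * mean_functional (normalize L).
  rewrite mulr_gt0 ?sqrtr_gt0 ?ltr0n// mean_functional_normalize//.
  by rewrite mulr_gt0 ?powR_gt0 ?vol_gt0 ?mean_functional_gt0.
have nkn0 : 0 < (n - k)%:R / n%:R :> R by rewrite divr_gt0 ?ltr0n ?subn_gt0.
have V0 : 0 <= V.
  by rewrite subr_ge0 ge0_ler_powR ?nnegrE ?(ltW nkn0) ?(ltW (vol_gt0 _)) ?vol_le.
(* If the volumes agree the bodies coincide.  The right-hand side is then 0 even
   if the distance is infinite, because [+oo * 0 = 0]. *)
have [VE|Vn0] := eqVneq V 0.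
  have LKE : L = K.
    apply: star_body_vol_inj => //; apply/eqP; apply: contraTT isT => vLK.
    have : vol L < vol K by rewrite lt_neqAle vLK vol_le.
    move=> /(gt0_ltr_powR nkn0); rewrite !nnegrE !(ltW (vol_gt0 _))// => /(_ isT isT).
    by rewrite -subr_gt0 -/V VE ltxx.
  have -> : e = 0.
    by apply/eqP; rewrite eq_le e0 andbT (le_trans (eF point))// LKE subrr.
  by rewrite mulr0 VE mule0.
have {Vn0}V0 : 0 < V by rewrite lt_def Vn0.
set A := _ * e.
have A0 : 0 <= A by rewrite !mulr_ge0// ?exprn_ge0// invr_ge0 exprn_ge0// ltW.
(* [A / V] bounds the [k]-th power of every ratio from below, so [r] bounds their
   infimum. *)
pose r := (A / V) `^ k%:R^-1.
have rk : r ^+ k = A / V.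
  rewrite -powR_mulrn ?powR_ge0// -powRrM mulVf ?pnatr_eq0 -?lt0n// powRr1//.
  by rewrite divr_ge0// ltW.
have rd : (r%:E <= dist_BP k L)%E.
  apply/ereal_infP => _ [D [DL gD] <-]; rewrite lee_fin.
  have sD : star_body D by case: gD.
  apply: ge0_ler_powR; rewrite ?nnegrE ?invr_ge0 ?divr_ge0 ?(ltW V0)//;
    try exact/ltW/radial_power_mean_gt0.
  by rewrite ler_pdivrMr//; exact: radial_power_mean_ratio.
have -> : A%:E = (r%:E ^+ k * V%:E)%E.
  by rewrite -EFin_expe -EFinM rk divfK// gt_eqF.
apply: lee_wpmul2r; first by rewrite lee_fin ltW.
by apply: lee_expe => //; rewrite lee_fin powR_ge0.
Qed.
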